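(* Let $R$ be a commutative ring and let $\mathcal{F}\colon\mathbf{MCob}\to R\mathbf{Mod}$ be an MTQFT with $V=\mathcal{F}(1)$ such that $\mathcal{F}(m^2)=\mathcal{F}(\mu\circ\Delta)$. Let $V$ be $\mathcal{G}$-graded for a finitely generated abelian group $\mathcal{G}$ with chosen generators $g_1,\dots,g_m$, and let $s\in\mathbb{Z}^m$ be a shift. Then for every perfect matching graph $\Gamma_M$ with trivalent underlying graph, $(C^{i,*}(\Gamma_M),\partial^i)$ is a chain complex of $R$-modules, i.e. $\partial^{i+1}\circ\partial^i=0$ for all $i$.
   Context: **Ribbon graphs.** Graphs are finite undirected multigraphs, connected with nonempty edge set. An (oriented) ribbon graph is a graph $G$ embedded in an oriented compact surface with boundary that deformation retracts onto $G$; equivalently, $G$ with a cyclic order of the half-edges at each vertex. It is represented by a ribbon diagram: a drawing of $G$ in the plane with vertices as dots and edges as curves that may cross, inducing the given cyclic orders counterclockwise. A perfect matching of $G$ is a set $M$ of edges such that each vertex is incident to exactly one edge in $M$ (matching edges have two distinct endpoints). A perfect matching graph $\Gamma_M$ is a ribbon graph with a perfect matching $M=\{e_1,\dots,e_\ell\}$ of its underlying graph. Trivalent: every vertex has degree 3. **Smoothings and states.** Draw a matching edge $e$ vertically, with the two other half-edges at its top vertex going up-left and up-right, and the two other half-edges at its bottom vertex going down-left and down-right. The 0-smoothing deletes $e$ and its endpoints and joins up-left with down-left and up-right with down-right; the 1-smoothing joins up-left with down-right and up-right with down-left (the strands cross). For $\alpha\in\{0,1\}^\ell$, the state $\Gamma_\alpha$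 is the collection of (immersed) circles obtained by applying the $\alpha_i$-smoothing at each $e_i$; $k_\alpha$ is its number of circles and $|\alpha|=\sum\alpha_i$. **MTQFTs.** $R\mathbf{Mod}$ is the symmetric monoidal category of finite-rank free $R$-modules. $\mathbf{MCob}$ is the symmetric monoidal category whose objects are nonnegative integers (numbers of circles with fixed orientation) and whose morphisms are diffeomorphism classes of possibly nonorientable two-dimensional cobordisms; it is presented as a symmetric monoidal category by generators $\mu\colon2\to1$, $\eta\colon0\to1$, $\Delta\colon1\to2$, $\epsilon\colon1\to0$, $m\colon1\to1$ ($m$ is a cylinder connected-summed with $\mathbb{RP}^2$), with the relations of a commutative Frobenius algebra for $(\mu,\eta,\Delta,\epsilon)$ together with $\mu\circ(m\otimes1)=m\circ\mu=\mu\circ(1\otimes m)$ and $m^3=\mu\circ\Delta\circ m$. An MTQFT is a symmetric monoidal functor $\mathcal{F}\colon\mathbf{MCob}\to R\mathbf{Mod}$. Write $\mu_V=\mathcal{F}(\mu)$, $\Delta_V=\mathcal{F}(\Delta)$, $m_V=\mathcal{F}(m)$. **Complex.** For $s=(s_1,\dots,s_m)$ the shift is $(V\{s\})_g=V_{g'}$, where $g=g_1^{p_1}\cdots g_m^{p_m}$ and $g'=g_1^{p_1-s_1}\cdots g_m^{p_m-s_m}$ (same underlying $R$-module). $V_\alpha=V^{\otimes k_\alpha}\{s|\alpha|\}$, with tensor factors indexed by the circles of $\Gamma_\alpha$. Put $C^{i,*}(\Gamma_M)=\bigoplus_{|\alpha|=i}V_\alpha$ for $0\le i\le\ell$ and $0$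 otherwise. If $\alpha'$ is obtained from $\alpha$ by changing one entry $0$ to $1$, then $\partial_{\alpha\alpha'}\colon V_\alpha\to V_{\alpha'}$ is $\mu_V$ if two circles merge, $\Delta_V$ if one circle splits into two, and $m_V$ if one circle is changed into one circle, on the affected tensor factors, and the identity on all other factors. For $v\in V_\alpha\subset C^{i,*}(\Gamma_M)$, $\partial^i(v)=\sum_{\alpha'}(-1)^{f_{\alpha\alpha'}}\partial_{\alpha\alpha'}(v)$, where the sum is over all such $\alpha'$ and $f_{\alpha\alpha'}$ is the number of entries 1 to the left of the entry where $\alpha,\alpha'$ differ. *)

(* Defs.v *)
From HB Require Import structures.
From mathcomp Require Import all_boot all_order all_fingroup all_algebra.

Set Implicit Arguments.
Unset Strict Implicit.
Unset Printing Implicit Defensive.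

Import GRing.Theory.
Local Open Scope ring_scope.

(* Morphism equality is a relation [heq], so that a category presented by
   generators and relations can use terms as its morphisms. *)
Record smcat := SMCat {
  ob :> Type;
  hom : ob -> ob -> Type;
  heq : forall a b, hom a b -> hom a b -> Prop;
  idm : forall a, hom a a;
  cmp : forall a b c, hom b c -> hom a b -> hom a c;
  one : ob;
  tob : ob -> ob -> ob;
  tho : forall a b c d, hom a b -> hom c d -> hom (tob a c) (tob b d);
  asc : forall a b c, hom (tob (tob a b) c) (tob a (tob b c));
  ascV : forall a b c, hom (tob a (tob b c)) (tob (tob a b) c);
  lun : forall a, hom (tob one a) a;
  lunV : forall a, hom a (tob one a);
  run : forall a, hom (tob a one) a;
  runV : forall a, hom a (tob a one);
  brd : forall a b, hom (tob a b) (tob b a);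
  heq_refl : forall a b (f : hom a b), heq f f;
  heq_sym : forall a b (f g : hom a b), heq f g -> heq g f;
  heq_trans : forall a b (f g h : hom a b), heq f g -> heq g h -> heq f h;
  heq_cmp : forall a b c (f f' : hom b c) (g g' : hom a b),
    heq f f' -> heq g g' -> heq (cmp f g) (cmp f' g');
  heq_tho : forall a b c d (f f' : hom a b) (g g' : hom c d),
    heq f f' -> heq g g' -> heq (tho f g) (tho f' g');
  cmpA : forall a b c d (f : hom c d) (g : hom b c) (h : hom a b),
    heq (cmp f (cmp g h)) (cmp (cmp f g) h);
  cmp1l : forall a b (f : hom a b), heq (cmp (idm b) f) f;
  cmp1r : forall a b (f : hom a b), heq (cmp f (idm a)) f;
  tho1 : forall a b, heq (tho (idm a) (idm b)) (idm (tob a b));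
  thoM : forall a b c a' b' c'
      (f : hom b c) (g : hom a b) (f' : hom b' c') (g' : hom a' b'),
    heq (tho (cmp f g) (cmp f' g')) (cmp (tho f f') (tho g g'));
  ascK : forall a b c, heq (cmp (ascV a b c) (asc a b c)) (idm _);
  ascVK : forall a b c, heq (cmp (asc a b c) (ascV a b c)) (idm _);
  lunK : forall a, heq (cmp (lunV a) (lun a)) (idm _);
  lunVK : forall a, heq (cmp (lun a) (lunV a)) (idm _);
  runK : forall a, heq (cmp (runV a) (run a)) (idm _);
  runVK : forall a, heq (cmp (run a) (runV a)) (idm _);
  brdK : forall a b, heq (cmp (brd b a) (brd a b)) (idm _);
  asc_nat : forall a b c a' b' c' (f : hom a a') (g : hom b b') (h : hom c c'),
    heq (cmp (asc a' b' c') (tho (tho f g) h))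
        (cmp (tho f (tho g h)) (asc a b c));
  lun_nat : forall a b (f : hom a b),
    heq (cmp (lun b) (tho (idm one) f)) (cmp f (lun a));
  run_nat : forall a b (f : hom a b),
    heq (cmp (run b) (tho f (idm one))) (cmp f (run a));
  brd_nat : forall a b c d (f : hom a b) (g : hom c d),
    heq (cmp (brd b d) (tho f g)) (cmp (tho g f) (brd a c));
  triangle : forall a b,
    heq (cmp (tho (idm a) (lun b)) (asc a one b)) (tho (run a) (idm b));
  pentagon : forall a b c d,
    heq (cmp (asc a b (tob c d)) (asc (tob a b) c d))
        (cmp (tho (idm a) (asc b c d))
             (cmp (asc a (tob b c) d) (tho (asc a b c) (idm d))));
  hexagon : forall a b c,
    heq (cmp (asc b c a) (cmp (brd a (tob b c)) (asc a b c)))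
        (cmp (tho (idm b) (brd a c))
             (cmp (asc b a c) (tho (brd a b) (idm c))))
}.

Arguments idm {_} _.
Arguments one {_}.
Arguments asc {_} _ _ _.
Arguments ascV {_} _ _ _.
Arguments lun {_} _.
Arguments lunV {_} _.
Arguments run {_} _.
Arguments runV {_} _.
Arguments brd {_} _ _.

(* Strong symmetric monoidal functors, with structure isomorphisms [fphi]
   and [fphi0]. *)
Record smfunctor (C D : smcat) := SMFunctor {
  fob :> C -> D;
  fhom : forall a b, hom a b -> hom (fob a) (fob b);
  fphi0 : hom (one : D) (fob one);
  fphi0V : hom (fob one) (one : D);
  fphi : forall a b, hom (tob (fob a) (fob b)) (fob (tob a b));
  fphiV : forall a b, hom (fob (tob a b)) (tob (fob a) (fob b));
  fhom_heq : forall a b (f g : hom a b), heq f g -> heq (fhom f) (fhom g);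
  fhom1 : forall a, heq (fhom (idm a)) (idm (fob a));
  fhomM : forall a b c (f : hom b c) (g : hom a b),
    heq (fhom (cmp f g)) (cmp (fhom f) (fhom g));
  fphi0K : heq (cmp fphi0V fphi0) (idm _);
  fphi0VK : heq (cmp fphi0 fphi0V) (idm _);
  fphiK : forall a b, heq (cmp (fphiV a b) (fphi a b)) (idm _);
  fphiVK : forall a b, heq (cmp (fphi a b) (fphiV a b)) (idm _);
  fphi_nat : forall a b c d (f : hom a b) (g : hom c d),
    heq (cmp (fphi b d) (tho (fhom f) (fhom g)))
        (cmp (fhom (tho f g)) (fphi a c));
  fphi_asc : forall a b c,
    heq (cmp (fhom (asc a b c))
             (cmp (fphi (tob a b) c) (tho (fphi a b) (idm (fob c)))))
        (cmp (fphi a (tob b c))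
             (cmp (tho (idm (fob a)) (fphi b c))
                  (asc (fob a) (fob b) (fob c))));
  fphi_lun : forall a,
    heq (cmp (fhom (lun a)) (cmp (fphi one a) (tho fphi0 (idm (fob a)))))
        (lun (fob a));
  fphi_run : forall a,
    heq (cmp (fhom (run a)) (cmp (fphi a one) (tho (idm (fob a)) fphi0)))
        (run (fob a));
  fphi_brd : forall a b,
    heq (cmp (fhom (brd a b)) (fphi a b)) (cmp (fphi b a) (brd (fob a) (fob b)))
}.

Inductive mcob : nat -> nat -> Type :=
| mc_id a : mcob a a
| mc_cmp a b c : mcob b c -> mcob a b -> mcob a c
| mc_tho a b c d : mcob a b -> mcob c d -> mcob (a + c)%N (b + d)%N
| mc_brd a b : mcob (a + b)%N (b + a)%N
| mc_mu : mcob 2 1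
| mc_eta : mcob 0 1
| mc_Delta : mcob 1 2
| mc_eps : mcob 1 0
| mc_m : mcob 1 1.

(* The monoidal structure is strict (disjoint union of circles), but the
   equalities [a + (b + c) = a + b + c] and [a + 0 = a] are not definitional:
   the associator and the unitors are identities transported along them. *)
Definition mc_cast a b (e : a = b) : mcob a b :=
  match e in _ = b return mcob a b with erefl => mc_id a end.

Definition mc_asc a b c : mcob (a + b + c)%N (a + (b + c))%N :=
  mc_cast (esym (addnA a b c)).
Definition mc_ascV a b c : mcob (a + (b + c))%N (a + b + c)%N :=
  mc_cast (addnA a b c).
Definition mc_run a : mcob (a + 0)%N a := mc_cast (addn0 a).
Definition mc_runV a : mcob a (a + 0)%N := mc_cast (esym (addn0 a)).

Declare Scope mcob_scope.
Delimit Scope mcob_scope with mcob.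
Bind Scope mcob_scope with mcob.
Notation "f \o g" := (mc_cmp f g) : mcob_scope.
Notation "f \x g" := (mc_tho f g) : mcob_scope.

Reserved Notation "f =mc g" (at level 70).

(* The constructors from [mc_mu_assoc] on are the defining relations; the
   others make the quotient the free symmetric strict monoidal category on the
   five generators [mc_mu], [mc_eta], [mc_Delta], [mc_eps] and [mc_m]. *)
Inductive mcob_eq : forall a b, mcob a b -> mcob a b -> Prop :=
| mc_refl a b (f : mcob a b) : f =mc f
| mc_sym a b (f g : mcob a b) : f =mc g -> g =mc f
| mc_trans a b (f g h : mcob a b) : f =mc g -> g =mc h -> f =mc h
| mc_cmp_eq a b c (f f' : mcob b c) (g g' : mcob a b) :
    f =mc f' -> g =mc g' -> f \o g =mc f' \o g'
| mc_tho_eq a b c d (f f' : mcob a b) (g g' : mcob c d) :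
    f =mc f' -> g =mc g' -> f \x g =mc f' \x g'
| mc_cmpA a b c d (f : mcob c d) (g : mcob b c) (h : mcob a b) :
    f \o (g \o h) =mc (f \o g) \o h
| mc_cmp1l a b (f : mcob a b) : mc_id b \o f =mc f
| mc_cmp1r a b (f : mcob a b) : f \o mc_id a =mc f
| mc_tho1 a b : mc_id a \x mc_id b =mc mc_id (a + b)
| mc_thoM a b c a' b' c'
    (f : mcob b c) (g : mcob a b) (f' : mcob b' c') (g' : mcob a' b') :
    (f \o g) \x (f' \o g') =mc (f \x f') \o (g \x g')
| mc_asc_nat a b c a' b' c' (f : mcob a a') (g : mcob b b') (h : mcob c c') :
    mc_asc a' b' c' \o ((f \x g) \x h) =mc (f \x (g \x h)) \o mc_asc a b c
| mc_lun_nat a b (f : mcob a b) : (mc_id 0 \x f) =mc f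
| mc_run_nat a b (f : mcob a b) :
    mc_run b \o (f \x mc_id 0) =mc f \o mc_run a
| mc_brd_nat a b c d (f : mcob a b) (g : mcob c d) :
    mc_brd b d \o (f \x g) =mc (g \x f) \o mc_brd a c
| mc_brdK a b : mc_brd b a \o mc_brd a b =mc mc_id (a + b)
| mc_hexagon a b c :
    mc_asc b c a \o (mc_brd a (b + c) \o mc_asc a b c) =mc
    (mc_id b \x mc_brd a c) \o (mc_asc b a c \o (mc_brd a b \x mc_id c))
| mc_mu_assoc : mc_mu \o (mc_mu \x mc_id 1) =mc mc_mu \o (mc_id 1 \x mc_mu)
| mc_mu_unitl : mc_mu \o (mc_eta \x mc_id 1) =mc mc_id 1
| mc_mu_unitr : mc_mu \o (mc_id 1 \x mc_eta) =mc mc_id 1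
| mc_mu_comm : mc_mu \o mc_brd 1 1 =mc mc_mu
| mc_Delta_coassoc :
    (mc_Delta \x mc_id 1) \o mc_Delta =mc (mc_id 1 \x mc_Delta) \o mc_Delta
| mc_Delta_counitl : (mc_eps \x mc_id 1) \o mc_Delta =mc mc_id 1
| mc_Delta_counitr : (mc_id 1 \x mc_eps) \o mc_Delta =mc mc_id 1
| mc_Delta_cocomm : mc_brd 1 1 \o mc_Delta =mc mc_Delta
| mc_frobl :
    (mc_mu \x mc_id 1) \o (mc_id 1 \x mc_Delta) =mc mc_Delta \o mc_mu
| mc_frobr :
    (mc_id 1 \x mc_mu) \o (mc_Delta \x mc_id 1) =mc mc_Delta \o mc_mu
| mc_m_mul : mc_mu \o (mc_m \x mc_id 1) =mc mc_m \o mc_mu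
| mc_m_mur : mc_m \o mc_mu =mc mc_mu \o (mc_id 1 \x mc_m)
| mc_m3 : mc_m \o mc_m \o mc_m =mc mc_mu \o mc_Delta \o mc_m
where "f =mc g" := (mcob_eq f%mcob g%mcob).

Local Open Scope mcob_scope.

Lemma mc_cast_irr a b (e e' : a = b) : mc_cast e =mc mc_cast e'.
Proof. by rewrite (eq_irrelevance e e'); apply: mc_refl. Qed.

Lemma mc_cast_cmp a b c (e : a = b) (e' : b = c) :
  mc_cast e' \o mc_cast e =mc mc_cast (etrans e e').
Proof. by case: _ / e' => /=; apply: mc_cmp1l. Qed.

Lemma mc_cast_id a (e : a = a) : mc_cast e =mc mc_id a.
Proof. exact: (mc_cast_irr e erefl). Qed.

Lemma mc_cast_tho a b c d (e : a = b) (e' : c = d) :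
  mc_cast e \x mc_cast e' =mc mc_cast (f_equal2 addn e e').
Proof.
case: _ / e; case: _ / e'.
exact: mc_trans (mc_tho1 a c) (mc_sym (mc_cast_id _)).
Qed.

Lemma mc_castK a b (e : a = b) (e' : b = a) : mc_cast e' \o mc_cast e =mc mc_id a.
Proof. exact: mc_trans (mc_cast_cmp _ _) (mc_cast_id _). Qed.

Lemma mc_lun_nat' a b (f : mcob a b) :
  mc_id b \o (mc_id 0 \x f) =mc f \o mc_id a.
Proof.
apply: mc_trans (mc_cmp1l _) _; apply: mc_trans (mc_lun_nat f) _.
exact: mc_sym (mc_cmp1r f).
Qed.

Lemma mc_triangle a b :
  (mc_id a \x mc_id b) \o mc_asc a 0 b =mc mc_run a \x mc_id b.
Proof.
apply: mc_trans (mc_cmp_eq (mc_tho1 a b) (mc_refl _)) _.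
apply: mc_trans (mc_cmp1l _) _.
apply: mc_trans _ (mc_sym (mc_cast_tho (addn0 a) (erefl b))).
exact: mc_cast_irr.
Qed.

Lemma mc_pentagon a b c d :
  mc_asc a b (c + d) \o mc_asc (a + b) c d =mc
  (mc_id a \x mc_asc b c d) \o
    (mc_asc a (b + c) d \o (mc_asc a b c \x mc_id d)).
Proof.
apply: mc_trans (mc_cast_cmp _ _) _; apply: mc_sym.
have h1 := mc_cast_tho (erefl a) (esym (addnA b c d)).
have h2 := mc_cast_tho (esym (addnA a b c)) (erefl d).
apply: mc_trans (mc_cmp_eq h1 (mc_cmp_eq (mc_refl _) h2)) _.
apply: mc_trans (mc_cmp_eq (mc_refl _) (mc_cast_cmp _ _)) _.
apply: mc_trans (mc_cast_cmp _ _) _; exact: mc_cast_irr.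
Qed.

Definition MCob : smcat :=
  @SMCat nat mcob mcob_eq mc_id mc_cmp 0%N addn mc_tho mc_asc mc_ascV
    mc_id mc_id mc_run mc_runV mc_brd
    mc_refl mc_sym mc_trans mc_cmp_eq mc_tho_eq mc_cmpA mc_cmp1l mc_cmp1r
    mc_tho1 mc_thoM
    (fun a b c => mc_castK _ _) (fun a b c => mc_castK _ _)
    (fun a => mc_cmp1l _) (fun a => mc_cmp1l _)
    (fun a => mc_castK _ _) (fun a => mc_castK _ _) mc_brdK
    mc_asc_nat mc_lun_nat' mc_run_nat mc_brd_nat mc_triangle mc_pentagon
    mc_hexagon.

Local Close Scope mcob_scope.

Section RMod.
Variable R : comPzRingType.

(* A finite-rank free module comes with a basis, indexed by a finite type;
   morphisms are arbitrary linear maps. *)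
Record freemod := FreeMod {
  fcar :> lmodType R;
  bas : finType;
  bvec : bas -> fcar;
  coord : {linear fcar -> {ffun bas -> R^o}};
  coord_bvec : forall x, coord (bvec x) = [ffun y => (y == x)%:R];
  coord_sum : forall v, v = \sum_x coord v x *: bvec x
}.

Arguments coord {_}.
Arguments coord_bvec {_}.
Implicit Types U V W : freemod.

Lemma coord_inj V : injective (@coord V).
Proof.
by move=> u v euv; rewrite (coord_sum u) (coord_sum v) euv.
Qed.

Section LinExt.
Variables (U : freemod) (V : lmodType R) (phi : bas U -> V).

Definition lin_ext (u : U) : V := \sum_x coord u x *: phi x.

Lemma lin_ext_is_linear : linear lin_ext.
Proof.
move=> a u v; rewrite /lin_ext scaler_sumr -big_split /=.
by apply: eq_bigr => x _; rewrite linearP !ffunE scalerDl scalerA.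
Qed.

HB.instance Definition _ :=
  GRing.isLinear.Build R U V *:%R lin_ext lin_ext_is_linear.

Lemma lin_ext_bvec x : lin_ext (bvec x) = phi x.
Proof.
rewrite /lin_ext (bigD1 x) //= coord_bvec ffunE eqxx scale1r big1 ?addr0 //.
by move=> y /negPf yx; rewrite ffunE yx scale0r.
Qed.
End LinExt.

Lemma lin_basisP U (V : lmodType R) (f g : {linear U -> V}) :
  (forall x, f (bvec x) = g (bvec x)) -> f =1 g.
Proof.
move=> fg v; rewrite (coord_sum v) !linear_sum.
by apply: eq_bigr => x _; rewrite !linearZ fg.
Qed.

Section FreeOn.
Variable X : finType.
Let F : lmodType R := {ffun X -> R^o}.
Let e (x : X) : F := [ffun y => (y == x)%:R].

Lemma free_on_sum (v : F) : v = \sum_x v x *: e x.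
Proof.
apply/ffunP => y; rewrite sum_ffunE (bigD1 y) //= !ffunE eqxx big1 ?addr0.
  by rewrite /GRing.scale /= mulr1.
by move=> x xy; rewrite !ffunE eq_sym (negPf xy) scaler0.
Qed.

Definition free_on : freemod :=
  @FreeMod F X e idfun (fun=> erefl) free_on_sum.
End FreeOn.

Definition rm_one : freemod := free_on unit.
Definition rm_tob U V : freemod := free_on (bas U * bas V)%type.

Definition ptens U V (u : U) (v : V) : rm_tob U V :=
  [ffun p => coord u p.1 * coord v p.2].

Lemma coord_ptens U V (u : U) (v : V) (p : bas (rm_tob U V)) :
  coord (ptens u v) p = coord u p.1 * coord v p.2.
Proof. exact: ffunE. Qed.

Lemma ptens_bvec U V (x : bas U) (y : bas V) :
  ptens (bvec x) (bvec y) = bvec ((x, y) : bas (rm_tob U V)).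
Proof.
apply/ffunP => -[x' y']; rewrite /= !ffunE /= !coord_bvec !ffunE xpair_eqE.
by rewrite -natrM mulnb.
Qed.

Definition rm_tho U U' V V' (f : {linear U -> U'}) (g : {linear V -> V'}) :
    {linear rm_tob U V -> rm_tob U' V'} :=
  @lin_ext (rm_tob U V) (rm_tob U' V')
    (fun p => ptens (f (bvec p.1)) (g (bvec p.2))).

Lemma rm_tho_bvec U U' V V' (f : {linear U -> U'}) (g : {linear V -> V'})
    (p : bas (rm_tob U V)) :
  rm_tho f g (bvec p) = ptens (f (bvec p.1)) (g (bvec p.2)).
Proof. exact: lin_ext_bvec. Qed.

Lemma rm_thoE U U' V V' (f : {linear U -> U'}) (g : {linear V -> V'}) u v :
  rm_tho f g (ptens u v) = ptens (f u) (g v).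
Proof.
rewrite /rm_tho /= /lin_ext; apply/ffunP => -[x y]; rewrite sum_ffunE ffunE /=.
rewrite (coord_sum u) (coord_sum v) !linear_sum !sum_ffunE.
rewrite big_distrlr /= pair_big -(coord_sum u) -(coord_sum v).
apply: eq_bigr => -[a b] _.
rewrite [f (_ *: _)]linearZ [g (_ *: _)]linearZ [coord (_ *: f _)]linearZ.
rewrite [coord (_ *: g _)]linearZ !ffunE /=.
by rewrite /GRing.scale /= mulrACA.
Qed.

(* The linear map induced by a map of bases, and its transpose; they are
   mutually inverse when [phi] is a bijection. *)
Definition bas_push U V (phi : bas U -> bas V) : {linear U -> V} :=
  @lin_ext U V (fun x => bvec (phi x)).
Definition bas_pull U V (phi : bas U -> bas V) : {linear V -> U} :=
  @lin_ext V U (fun y => \sum_(x | phi x == y) bvec x).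

Lemma bas_push_bvec U V (phi : bas U -> bas V) x :
  bas_push phi (bvec x) = bvec (phi x).
Proof. exact: lin_ext_bvec. Qed.

Lemma coord_bas_push U V (phi : bas U -> bas V) psi (u : U) y :
  cancel phi psi -> cancel psi phi ->
  coord (bas_push phi u) y = coord u (psi y).
Proof.
move=> phiK psiK; rewrite /bas_push /= /lin_ext linear_sum sum_ffunE.
rewrite (bigD1 (psi y)) //= linearZ /= ffunE psiK coord_bvec ffunE eqxx.
rewrite big1 ?addr0 => [|x xy]; first by rewrite /GRing.scale /= mulr1.
rewrite linearZ /= ffunE coord_bvec ffunE [y == _]negbTE ?scaler0 //.
by apply: contraNneq xy => ->; rewrite phiK.
Qed.

Definition rm_asc U V W :
    {linear rm_tob (rm_tob U V) W -> rm_tob U (rm_tob V W)} :=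
  @bas_push (rm_tob (rm_tob U V) W) (rm_tob U (rm_tob V W))
    (fun p => (p.1.1, (p.1.2, p.2))).
Definition rm_ascV U V W :
    {linear rm_tob U (rm_tob V W) -> rm_tob (rm_tob U V) W} :=
  @bas_push (rm_tob U (rm_tob V W)) (rm_tob (rm_tob U V) W)
    (fun p => ((p.1, p.2.1), p.2.2)).
Definition rm_lun V : {linear rm_tob rm_one V -> V} :=
  @bas_push (rm_tob rm_one V) V snd.
Definition rm_lunV V : {linear V -> rm_tob rm_one V} :=
  @bas_push V (rm_tob rm_one V) (pair tt).
Definition rm_run V : {linear rm_tob V rm_one -> V} :=
  @bas_push (rm_tob V rm_one) V fst.
Definition rm_runV V : {linear V -> rm_tob V rm_one} :=
  @bas_push V (rm_tob V rm_one) (fun x => (x, tt)).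
Definition rm_brd U V : {linear rm_tob U V -> rm_tob V U} :=
  @bas_push (rm_tob U V) (rm_tob V U) (fun p => (p.2, p.1)).

Lemma rm_ascE U V W (u : U) (v : V) (w : W) :
  rm_asc U V W (ptens (ptens u v) w) = ptens u (ptens v w).
Proof.
apply: coord_inj; apply/ffunP => -[x [y z]].
rewrite (@coord_bas_push (rm_tob (rm_tob U V) W) (rm_tob U (rm_tob V W)) _
  (fun p => ((p.1, p.2.1), p.2.2)));
  do ?[by case=> [[]] | by case=> [? []]].
by rewrite !coord_ptens mulrA.
Qed.

Lemma rm_lunE V (x : bas rm_one) (v : V) : rm_lun V (ptens (bvec x) v) = v.
Proof.
apply: coord_inj; apply/ffunP => y.
rewrite (@coord_bas_push (rm_tob rm_one V) V _ (pair tt)) //; last by case=> [[]].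
by case: x; rewrite coord_ptens coord_bvec ffunE mul1r.
Qed.

Lemma rm_runE V (x : bas rm_one) (v : V) : rm_run V (ptens v (bvec x)) = v.
Proof.
apply: coord_inj; apply/ffunP => y.
rewrite (@coord_bas_push (rm_tob V rm_one) V _ (fun y => (y, tt))) //; last by case=> [? []].
by case: x; rewrite coord_ptens coord_bvec ffunE mulr1.
Qed.

Lemma rm_brdE U V (u : U) (v : V) : rm_brd U V (ptens u v) = ptens v u.
Proof.
apply: coord_inj; apply/ffunP => -[x y].
rewrite (@coord_bas_push (rm_tob U V) (rm_tob V U) _ (fun p => (p.2, p.1))); do ?[by case].
by rewrite !coord_ptens mulrC.
Qed.

Lemma rm_asc_bvec U V W x y z :
  rm_asc U V W (bvec (((x, y), z) : bas (rm_tob (rm_tob U V) W))) =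
  bvec ((x, (y, z)) : bas (rm_tob U (rm_tob V W))).
Proof. exact: bas_push_bvec. Qed.

Lemma rm_ascV_bvec U V W x y z :
  rm_ascV U V W (bvec ((x, (y, z)) : bas (rm_tob U (rm_tob V W)))) =
  bvec (((x, y), z) : bas (rm_tob (rm_tob U V) W)).
Proof. exact: bas_push_bvec. Qed.

Lemma rm_lun_bvec V t x :
  rm_lun V (bvec ((t, x) : bas (rm_tob rm_one V))) = bvec x.
Proof. exact: bas_push_bvec. Qed.

Lemma rm_lunV_bvec V x :
  rm_lunV V (bvec x) = bvec ((tt, x) : bas (rm_tob rm_one V)).
Proof. exact: bas_push_bvec. Qed.

Lemma rm_run_bvec V t x :
  rm_run V (bvec ((x, t) : bas (rm_tob V rm_one))) = bvec x.
Proof. exact: bas_push_bvec. Qed.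

Lemma rm_runV_bvec V x :
  rm_runV V (bvec x) = bvec ((x, tt) : bas (rm_tob V rm_one)).
Proof. exact: bas_push_bvec. Qed.

Lemma rm_brd_bvec U V x y :
  rm_brd U V (bvec ((x, y) : bas (rm_tob U V))) =
  bvec ((y, x) : bas (rm_tob V U)).
Proof. exact: bas_push_bvec. Qed.

Definition rm_hom U V := {linear U -> V}.
Definition rm_heq U V (f g : rm_hom U V) := f =1 g.
Definition rm_id U : rm_hom U U := idfun.
Definition rm_cmp U V W (f : rm_hom V W) (g : rm_hom U V) : rm_hom U W :=
  f \o g.

Lemma rm_cmpE U V W (f : rm_hom V W) (g : rm_hom U V) x :
  rm_cmp f g x = f (g x).
Proof. by []. Qed.

Definition RMod : smcat.
Proof.
unshelve refine (@SMCat freemod rm_hom rm_heq rm_id rm_cmp rm_one rm_tob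
  rm_tho rm_asc rm_ascV rm_lun rm_lunV rm_run rm_runV rm_brd
  _ _ _ _ _ _ _ _ _ _ _ _ _ _ _ _ _ _ _ _ _ _ _ _).
- by move=> U V f x.
- by move=> U V f g fg x; rewrite fg.
- by move=> U V f g h fg gh x; rewrite fg gh.
- by move=> U V W f f' g g' ff gg x; rewrite !rm_cmpE ff gg.
- move=> U U' V V' f f' g g' ff gg; apply: lin_basisP => x.
  by rewrite !rm_tho_bvec ff gg.
- by move=> U V W Z f g h x.
- by move=> U V f x.
- by move=> U V f x.
- move=> U V; apply: lin_basisP => x.
  by rewrite rm_tho_bvec ptens_bvec; case: x.
- move=> U V W U' V' W' f g f' g'; apply: lin_basisP => x.
  by rewrite !rm_cmpE !rm_tho_bvec !rm_cmpE rm_thoE.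
- move=> U V W; apply: lin_basisP => -[[x y] z].
  by rewrite rm_cmpE rm_asc_bvec rm_ascV_bvec.
- move=> U V W; apply: lin_basisP => -[x [y z]].
  by rewrite rm_cmpE rm_ascV_bvec rm_asc_bvec.
- move=> V; apply: lin_basisP => -[[] x].
  by rewrite rm_cmpE rm_lun_bvec rm_lunV_bvec.
- move=> V; apply: lin_basisP => x.
  by rewrite rm_cmpE rm_lunV_bvec rm_lun_bvec.
- move=> V; apply: lin_basisP => -[x []].
  by rewrite rm_cmpE rm_run_bvec rm_runV_bvec.
- move=> V; apply: lin_basisP => x.
  by rewrite rm_cmpE rm_runV_bvec rm_run_bvec.
- move=> U V; apply: lin_basisP => -[x y].
  by rewrite rm_cmpE !rm_brd_bvec.
- move=> U V W U' V' W' f g h; apply: lin_basisP => -[[x y] z].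
  by rewrite !rm_cmpE rm_asc_bvec !rm_tho_bvec rm_ascE.
- move=> U V f; apply: lin_basisP => -[x y].
  by rewrite !rm_cmpE rm_lun_bvec rm_tho_bvec rm_lunE.
- move=> U V f; apply: lin_basisP => -[x y].
  by rewrite !rm_cmpE rm_run_bvec rm_tho_bvec rm_runE.
- move=> U V U' V' f g; apply: lin_basisP => -[x y].
  by rewrite !rm_cmpE rm_brd_bvec !rm_tho_bvec rm_brdE.
- move=> U V; apply: lin_basisP => -[[x t] y].
  by rewrite rm_cmpE rm_asc_bvec !rm_tho_bvec rm_lun_bvec rm_run_bvec.
- move=> U V W Z; apply: lin_basisP => -[[[x y] z] t].
  rewrite !rm_cmpE !rm_asc_bvec rm_tho_bvec rm_asc_bvec ptens_bvec.
  by rewrite rm_asc_bvec rm_tho_bvec rm_asc_bvec ptens_bvec.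
- move=> U V W; apply: lin_basisP => -[[x y] z].
  rewrite !rm_cmpE rm_asc_bvec rm_brd_bvec rm_asc_bvec rm_tho_bvec rm_brd_bvec.
  by rewrite ptens_bvec rm_asc_bvec rm_tho_bvec rm_brd_bvec ptens_bvec.
Defined.

End RMod.

Arguments coord {_ _}.
Arguments coord_bvec {_ _}.
Arguments coord_sum {_ _}.

Definition MTQFT (R : comPzRingType) := smfunctor MCob (RMod R).

Section MTQFTOps.
Variables (R : comPzRingType) (F : MTQFT R).

Definition mt_V : freemod R := F 1%N.

Definition mt_F a b (f : mcob a b) :
    {linear (F a : freemod R) -> (F b : freemod R)} :=
  @fhom MCob (RMod R) F a b f.

(* [F 2] is identified with [V (x) V] through the structure isomorphism. *)
Definition mt_mu : {linear rm_tob mt_V mt_V -> mt_V} :=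
  @cmp (RMod R) _ _ _ (mt_F mc_mu) (@fphi MCob (RMod R) F 1%N 1%N).
Definition mt_Delta : {linear mt_V -> rm_tob mt_V mt_V} :=
  @cmp (RMod R) _ _ _ (@fphiV MCob (RMod R) F 1%N 1%N) (mt_F mc_Delta).
Definition mt_m : {linear mt_V -> mt_V} := mt_F mc_m.

End MTQFTOps.

Section Graded.
Variables (R : comPzRingType) (G : zmodType).

(* A module with a [G]-indexed family of homogeneous parts; see [is_grading]
   for the direct sum condition. *)
Record gmod := GMod {
  gcar :> lmodType R;
  gpart : G -> gcar -> Prop
}.

Inductive lspan (V : lmodType R) (P : V -> Prop) : V -> Prop :=
| lspan0 : lspan P 0
| lspanD a u v : P u -> lspan P v -> lspan P (a *: u + v).

Definition is_submod (V : lmodType R) (P : V -> Prop) :=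
  P 0 /\ forall a u v, P u -> P v -> P (a *: u + v).

(* The module is the internal direct sum of its homogeneous parts. *)
Definition is_grading (V : lmodType R) (P : G -> V -> Prop) :=
  [/\ forall g, is_submod (P g),
      forall v, lspan (fun u => exists g, P g u) v
    & forall (S : seq G) (w : G -> V), uniq S -> (forall g, P g (w g)) ->
        \sum_(g <- S) w g = 0 -> forall g, g \in S -> w g = 0].

(* [G] is written additively: the degree [g_1^{p_1} ... g_m^{p_m}] is
   [gdeg gens p]. *)
Definition gdeg m (gens : 'I_m -> G) (p : 'I_m -> int) : G :=
  \sum_j gens j *~ p j.

Definition generates m (gens : 'I_m -> G) :=
  forall g, exists p, g = gdeg gens p.

(* [(V{s})_g = V_{g'}] with [g' = g - gdeg gens s]. *)
Definition gshift m (gens : 'I_m -> G) (s : 'I_m -> int) (V : gmod) : gmod :=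
  GMod (fun g => @gpart V (g - gdeg gens s)).

Section TensorPower.
Variables (V : freemod R) (I : finType).

(* The tensor power of [V] with factors indexed by [I]. *)
Definition tpow : freemod R := free_on R {ffun I -> bas V}.

Definition ptpow (v : I -> V) : tpow :=
  [ffun x : {ffun I -> bas V} => \prod_i coord (v i) (x i)].

Definition gtpow (P : G -> V -> Prop) : gmod :=
  @GMod tpow (fun g => lspan (fun t => exists (w : I -> V) (d : I -> G),
    [/\ forall i, P (d i) (w i), \sum_i d i = g & t = ptpow w])).
End TensorPower.

End Graded.

Section DirectSum.
Variables (R : comPzRingType) (I : finType) (T : I -> lmodType R).

Definition dsum := {dffun forall i, T i}.
HB.instance Definition _ := Choice.on dsum.

Let add (u v : dsum) : dsum := finfun (fun i => u i + v i).
Let zero : dsum := finfun (fun i => 0).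
Let opp (u : dsum) : dsum := finfun (fun i => - u i).
Let scale (a : R) (u : dsum) : dsum := finfun (fun i => a *: u i).

Fact dsum_addA : associative add.
Proof. by move=> u v w; apply/ffunP => i; rewrite !ffunE addrA. Qed.
Fact dsum_addC : commutative add.
Proof. by move=> u v; apply/ffunP => i; rewrite !ffunE addrC. Qed.
Fact dsum_add0 : left_id zero add.
Proof. by move=> u; apply/ffunP => i; rewrite !ffunE add0r. Qed.
Fact dsum_addN : left_inverse zero opp add.
Proof. by move=> u; apply/ffunP => i; rewrite !ffunE addNr. Qed.
HB.instance Definition _ :=
  GRing.isZmodule.Build dsum dsum_addA dsum_addC dsum_add0 dsum_addN.

Fact dsum_scaleA a b (v : dsum) : scale a (scale b v) = scale (a * b) v.
Proof. by apply/ffunP => i; rewrite !ffunE scalerA. Qed.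
Fact dsum_scale1 : left_id 1 scale.
Proof. by move=> v; apply/ffunP => i; rewrite !ffunE scale1r. Qed.
Fact dsum_scaleDr : right_distributive scale +%R.
Proof. by move=> a u v; apply/ffunP => i; rewrite !ffunE scalerDr. Qed.
Fact dsum_scaleDl (v : dsum) : {morph scale^~ v : a b / a + b}.
Proof. by move=> a b; apply/ffunP => i; rewrite !ffunE scalerDl. Qed.
HB.instance Definition _ := GRing.Zmodule_isLmodule.Build R dsum
  dsum_scaleA dsum_scale1 dsum_scaleDr dsum_scaleDl.

Lemma dsumDE (u v : dsum) i : (u + v) i = u i + v i.
Proof. by rewrite ffunE. Qed.
Lemma dsumZE a (v : dsum) i : (a *: v) i = a *: v i.
Proof. by rewrite ffunE. Qed.
End DirectSum.

Definition gdsum (R : comPzRingType) (G : zmodType) (I : finType)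
    (V : I -> gmod R G) : gmod R G :=
  @GMod R G (dsum (fun i => gcar (V i)))
    (fun g v => forall i, gpart g ((v : dsum _) i)).

(* A connected ribbon graph with nonempty edge set, as a combinatorial map on
   its half-edges: vertices are the orbits of [nxt], which gives the next
   half-edge counterclockwise, and edges are the orbits of [flip]. *)
Record ribbon := Ribbon {
  half : finType;
  nxt : {perm half};
  flip : half -> half;
  flipK : involutive flip;
  flip_neq : forall h, flip h != h;
  half_gt0 : (0 < #|half|)%N;
  half_conn : forall h k,
    connect (fun x y => (y == nxt x) || (y == flip x)) h k
}.

Section Ribbon.
Variable Gm : ribbon.
Local Notation H := (half Gm).

Definition vertices : {set {set H}} := porbits (nxt Gm).
Definition edges : {set {set H}} := [set [set h; flip h] | h : H].
Definition incident (v e : {set H}) : bool := v :&: e != set0.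
Definition trivalent : Prop := forall v, v \in vertices -> #|v| = 3%N.

(* [M = {e_1, ..., e_l}], with the chosen order of its edges. *)
Record matching := Matching {
  msize : nat;
  medge : 'I_msize -> {set H};
  medge_inj : injective medge;
  medge_edge : forall j, medge j \in edges;
  medge_ends : forall j h, h \in medge j ->
    porbit (nxt Gm) h != porbit (nxt Gm) (flip h);
  medge_perfect : forall v, v \in vertices ->
    exists! j, incident v (medge j)
}.
End Ribbon.

Section States.
Variables (Gm : ribbon) (M : matching Gm).
Local Notation H := (half Gm).
Local Notation nx := (nxt Gm).

Definition state := {ffun 'I_(msize M) -> bool}.
Implicit Types (al be : state) (j : 'I_(msize M)).

(* When the matching edge [{h, flip h}] is vertical with [h] at the top,
   [nx h] and [nx (nx h)] point up-right and up-left, while [nx (flip h)] and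
   [nx (nx (flip h))] point down-left and down-right. *)
Definition arc (b : bool) (h x y : H) : bool :=
  if b then ((x == nx (nx h)) && (y == nx (nx (flip h))))
            || ((x == nx h) && (y == nx (flip h)))
  else ((x == nx (nx h)) && (y == nx (flip h)))
       || ((x == nx h) && (y == nx (nx (flip h)))).

Definition adj al (x y : H) : bool :=
  (y == flip x) || [exists j, exists h in medge j, arc (al j) h x y].

Definition unmatched : {set H} :=
  [set h | [forall j, h \notin medge (m := M) j]].

(* A circle is recorded as the set of half-edges it runs through. *)
Definition circles al : {set {set H}} :=
  [set [set y | connect (adj al) x y] | x in unmatched].
Definition circle al : finType := {c : {set H} | c \in circles al}.

Definition ends j : {set H} :=
  \bigcup_(h in medge j) [set nx h; nx (nx h)].

Definition affected al j : {set circle al} :=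
  [set c | val c :&: ends j != set0].

(* The circles common to [al] and [be] away from the edge [e_j]; when [be] is
   [al] with its [j]-th entry changed, these are all the unaffected circles of
   [al], and all those of [be]. *)
Definition common al be j : finType :=
  {c : {set H} | [&& c \in circles al, c \in circles be & c :&: ends j == set0]}.

Lemma common_inl_subproof al be j (c : common al be j) : val c \in circles al.
Proof. by case/and3P: (valP c). Qed.
Lemma common_inr_subproof al be j (c : common al be j) : val c \in circles be.
Proof. by case/and3P: (valP c). Qed.
Definition common_inl al be j (c : common al be j) : circle al :=
  Sub (val c) (common_inl_subproof c).
Definition common_inr al be j (c : common al be j) : circle be :=
  Sub (val c) (common_inr_subproof c).

Definition weight al : nat := #|[set j | al j]|.

(* [be] is obtained from [al] by changing its [j]-th entry from 0 to 1. *)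
Definition step al be j : bool :=
  ~~ al j && (be == [ffun k => (k == j) || al k]).

Definition sgn_exp al j : nat := #|[set k : 'I_(msize M) | (k < j)%N && al k]|.

Definition level (i : int) : finType := {al : state | (weight al)%:Z == i}.
End States.

Section Complex.
Variables (R : comPzRingType) (F : MTQFT R).
Local Notation V := (mt_V F).

Section Factors.
Variables (I U : finType) (inj : U -> I).

(* [split1 inj a] and [join1 inj a] are the mutually inverse identifications of
   the tensor power over [I] with [V (x) V^{(x) U}] when [I] is the disjoint
   union of [{a}] and the image of [inj], and similarly for two factors. *)
Definition sel1 (a : I) (x : bas (tpow V I)) : bas (rm_tob V (tpow V U)) :=
  (x a, [ffun u => x (inj u)]).
Definition sel2 (a b : I) (x : bas (tpow V I)) :
    bas (rm_tob (rm_tob V V) (tpow V U)) :=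
  ((x a, x b), [ffun u => x (inj u)]).

Definition split1 a := bas_push (sel1 a).
Definition join1 a := bas_pull (sel1 a).
Definition split2 a b := bas_push (sel2 a b).
Definition join2 a b := bas_pull (sel2 a b).
End Factors.

Section Complex.
Variables (G : zmodType) (m : nat) (gens : 'I_m -> G).
Variables (P : G -> V -> Prop) (s : 'I_m -> int).
Variables (Gm : ribbon) (M : matching Gm).

Definition V_ (al : state M) : gmod R G :=
  gshift gens (fun k => s k * (weight al)%:Z) (gtpow (circle al) P).

(* Of the pairs of lists matched below only the first three occur along a step
   from [al] to [be].  The order in which the two circles of a merge or a split
   are listed is immaterial, [mu] being commutative and [Delta]
   cocommutative. *)
Definition edge_map (al be : state M) (j : 'I_(msize M)) :
    {linear V_ al -> V_ be} :=
  let inl := @common_inl _ _ al be j in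
  let inr := @common_inr _ _ al be j in
  match enum (affected al j), enum (affected be j) with
  | [:: a; b], [:: c] =>
      join1 inr c \o (rm_tho (mt_mu F) idfun \o split2 inl a b)
  | [:: a], [:: b; c] =>
      join2 inr b c \o (rm_tho (mt_Delta F) idfun \o split1 inl a)
  | [:: a], [:: c] =>
      join1 inr c \o (rm_tho (mt_m F) idfun \o split1 inl a)
  | _, _ => \0
  end.

(* Zero unless [0 <= i <= msize M], the index type being then empty. *)
Definition Cx (i : int) : gmod R G := gdsum (fun al : level M i => V_ (val al)).

(* The [be]-component of the image of [v]: every pair [al], [j] with
   [step al be j] contributes. *)
Definition dif_fun (i : int) (v : Cx i) : Cx (i + 1) :=
  finfun (fun be : level M (i + 1) =>
    \sum_(al : level M i) \sum_(j | step (val al) (val be) j)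
      (-1) ^+ sgn_exp (val al) j *:
        edge_map (val al) (val be) j ((v : dsum _) al)).

Lemma dif_is_linear i : linear (@dif_fun i).
Proof.
move=> a u v; apply/ffunP => be; rewrite dsumDE dsumZE !ffunE.
rewrite scaler_sumr -big_split; apply: eq_bigr => al _.
rewrite scaler_sumr -big_split; apply: eq_bigr => j _ /=.
by rewrite dsumDE dsumZE linearP scalerDr !scalerA mulrC.
Qed.

HB.instance Definition _ i :=
  GRing.isLinear.Build R (Cx i) (Cx (i + 1)) *:%R
    (@dif_fun i) (@dif_is_linear i).

Definition dif (i : int) : {linear Cx i -> Cx (i + 1)} := @dif_fun i.

End Complex.
End Complex.

(* Main.v *)
Require Import Defs.
From HB Require Import structures.
From mathcomp Require Import all_boot all_order all_fingroup all_algebra.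

Set Implicit Arguments.
Unset Strict Implicit.
Unset Printing Implicit Defensive.

Import GRing.Theory Order.TTheory.
Local Open Scope ring_scope.

(** An MTQFT makes [V] a commutative Frobenius algebra with an element
    [theta = m 1] such that [m] is multiplication by [theta], and the hypothesis
    says that [theta ^ 2 = mu (Delta 1)].  Label the half-edges by elements of [V]
    and give each circle of a state the product of its labels.  On such tensors,
    which span, the three kinds of edge maps multiply the labels by [1], by [theta]
    at one end of the matching edge, or by [Delta 1] at two ends on the two new
    circles.  So the two ways around a square multiply by two elements, each a
    product of two local ones, and one has to see that they agree in the last state.
    This depends only on the four partitions of the half-edges into circles: the
    number of circles gives the same total change along both ways, and every
    remaining case is settled by moving labels along circles, by the Frobenius
    relation, and, when [Delta 1] falls on a single circle, by the hypothesis.  The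
    classification of the edge maps is a parity argument: away from the matching
    edge, each component of the strands contains an even number of its four ends. *)

(** * The Frobenius algebra of an MTQFT *)

Section PureTensors.
Variables (R : comPzRingType) (U V : freemod R).

Lemma ptens_linearl (v : V) : linear (fun u : U => ptens u v).
Proof.
move=> a x y; apply/ffunP => p; rewrite !ffunE /= linearP !ffunE /=.
by rewrite mulrDl /GRing.scale /= mulrA.
Qed.

Lemma ptens_linearr (u : U) : linear (fun v : V => ptens u v).
Proof.
move=> a x y; apply/ffunP => p; rewrite !ffunE /= linearP !ffunE /=.
by rewrite mulrDr /GRing.scale /= mulrCA.
Qed.

HB.instance Definition _ (u : U) :=
  GRing.isLinear.Build R V (rm_tob U V) *:%R (ptens u) (ptens_linearr u).

Lemma tens_sum (t : rm_tob U V) :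
  t = \sum_(p : bas U * bas V) Defs.coord t p *: ptens (bvec p.1) (bvec p.2).
Proof.
rewrite {1}(coord_sum t); apply: eq_bigr => -[a b] _.
by rewrite ptens_bvec.
Qed.

(** Linearity is a hypothesis on a bare function here, to serve maps such as [fun u => ptens u v]
    that carry no bundled linear structure. *)
Lemma linear_comb (W : lmodType R) (f : U -> W) (I : finType) (a : I -> R)
    (x : I -> U) :
  linear f -> f (\sum_i a i *: x i) = \sum_i a i *: f (x i).
Proof.
move=> lf; have f0 : f 0 = 0.
  by have := lf (-1) 0 0; rewrite !scaleN1r addr0 oppr0 addNr.
have fD : {morph f : u v / u + v}.
  by move=> u v; rewrite -{1}[u]scale1r lf scale1r.
rewrite (big_morph f fD f0); apply: eq_bigr => i _.
by rewrite -[_ *: x i]addr0 lf f0 addr0.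
Qed.

End PureTensors.

Section RModMaps.
Variable R : comPzRingType.
Implicit Types U V W : freemod R.

Lemma rmod_heqE U V (f g : {linear U -> V}) :
  @Defs.heq (RMod R) U V f g -> forall x, f x = g x.
Proof. by []. Qed.

Lemma rmod_cmpE U V W (f : {linear V -> W}) (g : {linear U -> V}) x :
  (@cmp (RMod R) U V W f g : {linear U -> W}) x = f (g x).
Proof. by []. Qed.

Lemma rmod_thoE U V U' V' (f : {linear U -> U'}) (g : {linear V -> V'}) u v :
  (@Defs.tho (RMod R) U U' V V' f g :
     {linear rm_tob U V -> rm_tob U' V'}) (ptens u v) =
  ptens (f u) (g v).
Proof. exact: rm_thoE. Qed.

Lemma rmod_ascE U V W u v w :
  (@Defs.asc (RMod R) U V W :
     {linear rm_tob (rm_tob U V) W -> rm_tob U (rm_tob V W)})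
    (ptens (ptens u v) w) = ptens u (ptens v w).
Proof. exact: rm_ascE. Qed.

Lemma rmod_idE U x : (@Defs.idm (RMod R) U : {linear U -> U}) x = x.
Proof. by []. Qed.

Lemma rmod_lunE U t x :
  (@Defs.lun (RMod R) U : {linear rm_tob (rm_one R) U -> U}) (ptens (bvec t) x) = x.
Proof. exact: rm_lunE. Qed.

Lemma rmod_brdE U V :
  (@Defs.brd (RMod R) U V : {linear rm_tob U V -> rm_tob V U}) = rm_brd U V.
Proof. by []. Qed.

End RModMaps.

(** * Monoidal functors into free modules, evaluated on elements *)

Section FunctorMaps.
Variables (R : comPzRingType) (C : smcat) (F : smfunctor C (RMod R)).
Local Notation Fo a := (@fob C (RMod R) F a : freemod R).

Definition fmap a b (f : @Defs.hom C a b) : {linear Fo a -> Fo b} := fhom F f.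
Definition fmerge a b : {linear rm_tob (Fo a) (Fo b) -> Fo (Defs.tob a b)} :=
  fphi F a b.
Definition fmergeV a b : {linear Fo (Defs.tob a b) -> rm_tob (Fo a) (Fo b)} :=
  fphiV F a b.
Definition fmerge0 : {linear rm_one R -> Fo Defs.one} := fphi0 F.

Lemma fmap_cmp a b c (f : @Defs.hom C b c) (g : @Defs.hom C a b) x :
  fmap (Defs.cmp f g) x = fmap f (fmap g x).
Proof.
have H := rmod_heqE (fhomM F f g) x.
by rewrite rmod_cmpE in H.
Qed.

Lemma fmap_id a x : fmap (Defs.idm a) x = x.
Proof.
have H := rmod_heqE (fhom1 F a) x.
by rewrite rmod_idE in H.
Qed.

Lemma fmap_heq a b (f g : @Defs.hom C a b) : Defs.heq f g -> fmap f =1 fmap g.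
Proof. by move=> fg x; exact: (rmod_heqE (fhom_heq F fg) x). Qed.

Lemma fmap_fmerge a b c d (f : @Defs.hom C a b) (g : @Defs.hom C c d) x y :
  fmap (Defs.tho f g) (fmerge a c (ptens x y)) =
  fmerge b d (ptens (fmap f x) (fmap g y)).
Proof.
have H := rmod_heqE (fphi_nat F f g) (ptens x y).
rewrite !rmod_cmpE rmod_thoE in H.
exact: esym H.
Qed.

Lemma fmergeK a b t : fmergeV a b (fmerge a b t) = t.
Proof.
have H := rmod_heqE (fphiK F a b) t.
by rewrite rmod_cmpE rmod_idE in H.
Qed.

Lemma fmergeVK a b t : fmerge a b (fmergeV a b t) = t.
Proof.
have H := rmod_heqE (fphiVK F a b) t.
by rewrite rmod_cmpE rmod_idE in H.
Qed.

Lemma fmerge_asc a b c x y z :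
  fmap (Defs.asc a b c) (fmerge (Defs.tob a b) c (ptens (fmerge a b (ptens x y)) z)) =
  fmerge a (Defs.tob b c) (ptens x (fmerge b c (ptens y z))).
Proof.
have H := rmod_heqE (fphi_asc F a b c) (ptens (ptens x y) z).
rewrite !rmod_cmpE rmod_ascE !rmod_thoE !rmod_idE in H.
exact: H.
Qed.

Lemma fmerge_lun a x :
  fmap (Defs.lun a) (fmerge Defs.one a (ptens (fmerge0 (bvec (tt : bas (rm_one R)))) x)) = x.
Proof.
have H := rmod_heqE (fphi_lun F a) (ptens (bvec (tt : bas (rm_one R))) x).
rewrite !rmod_cmpE rmod_thoE rmod_idE rmod_lunE in H.
exact: H.
Qed.

Lemma fmerge_brd a b t :
  fmap (Defs.brd a b) (fmerge a b t) = fmerge b a (rm_brd (Fo a) (Fo b) t).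
Proof.
have H := rmod_heqE (fphi_brd F a b) t.
by rewrite !rmod_cmpE rmod_brdE in H.
Qed.

End FunctorMaps.

Section FrobeniusAlgebra.
Variables (R : comPzRingType) (F : MTQFT R).
Local Notation V := (mt_V F).
Local Notation Fo n := (@fob MCob (RMod R) F n : freemod R).

Definition mt_phi a b : {linear rm_tob (Fo a) (Fo b) -> Fo (a + b)%N} :=
  @fphi MCob (RMod R) F a b.
Definition mt_phiV a b : {linear Fo (a + b)%N -> rm_tob (Fo a) (Fo b)} :=
  @fphiV MCob (RMod R) F a b.
Definition mt_phi0 : {linear rm_one R -> Fo 0%N} := @fphi0 MCob (RMod R) F.

Definition vmul (x y : V) : V := mt_mu F (ptens x y).
Definition vone : V := mt_F F mc_eta (mt_phi0 (bvec (tt : bas (rm_one R)))).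
Definition vtheta : V := mt_m F vone.

Lemma mt_FM a b c (f : mcob b c) (g : mcob a b) x :
  mt_F F (mc_cmp f g) x = mt_F F f (mt_F F g x).
Proof. exact: (@fmap_cmp R MCob F a b c f g x). Qed.

Lemma mt_F_eq a b (f g : mcob a b) : mcob_eq f g -> mt_F F f =1 mt_F F g.
Proof. exact: (@fmap_heq R MCob F a b f g). Qed.

Lemma mt_F_id a x : mt_F F (mc_id a) x = x.
Proof. exact: (@fmap_id R MCob F a x). Qed.

Lemma mt_F_phi a b c d (f : mcob a b) (g : mcob c d) x y :
  mt_F F (mc_tho f g) (mt_phi a c (ptens x y)) =
  mt_phi b d (ptens (mt_F F f x) (mt_F F g y)).
Proof. exact: (@fmap_fmerge R MCob F a b c d f g x y). Qed.

Lemma mt_phiK a b t : mt_phiV a b (mt_phi a b t) = t.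
Proof. exact: (@fmergeK R MCob F a b t). Qed.

Lemma mt_phiVK a b t : mt_phi a b (mt_phiV a b t) = t.
Proof. exact: (@fmergeVK R MCob F a b t). Qed.

Lemma mt_brd t : mt_F F (mc_brd 1 1) (mt_phi 1 1 t) = mt_phi 1 1 (rm_brd V V t).
Proof. exact: (@fmerge_brd R MCob F 1%N 1%N t). Qed.

Lemma mt_lun x : mt_F F (mc_id 1) (mt_phi 0 1 (ptens (mt_phi0 (bvec (tt : bas (rm_one R)))) x)) = x.
Proof. exact: (@fmerge_lun R MCob F 1%N x). Qed.

Lemma mt_asc (x y z : V) :
  mt_F F (mc_asc 1 1 1) (mt_phi 2 1 (ptens (mt_phi 1 1 (ptens x y)) z)) =
  mt_phi 1 2 (ptens x (mt_phi 1 1 (ptens y z))).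
Proof. exact: (@fmerge_asc R MCob F 1%N 1%N 1%N x y z). Qed.

Lemma vmulE x y : vmul x y = mt_F F mc_mu (mt_phi 1 1 (ptens x y)).
Proof. by []. Qed.

Lemma mt_DeltaE x : mt_phi 1 1 (mt_Delta F x) = mt_F F mc_Delta x.
Proof. exact: mt_phiVK. Qed.

(** Both bracketings compute to [3], so this associator is a transport along a proof of [3 = 3]. It
    lets the two identifications of [F 3] with a triple tensor product be exchanged. *)
Lemma mc_asc111 : mcob_eq (mc_asc 1 1 1) (mc_id 3).
Proof. exact: mc_cast_id. Qed.

Lemma mt_phi_asc (x y z : V) :
  mt_phi 2 1 (ptens (mt_phi 1 1 (ptens x y)) z) =
  mt_phi 1 2 (ptens x (mt_phi 1 1 (ptens y z))).
Proof.
by rewrite -mt_asc (mt_F_eq mc_asc111) mt_F_id.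
Qed.

Lemma vmulA x y z : vmul x (vmul y z) = vmul (vmul x y) z.
Proof.
have H := mt_F_eq mc_mu_assoc (mt_phi 2 1 (ptens (mt_phi 1 1 (ptens x y)) z)).
rewrite !mt_FM [in RHS]mt_phi_asc in H.
rewrite (mt_F_phi mc_mu) (mt_F_phi (mc_id 1)) !mt_F_id in H.
exact: esym H.
Qed.

Lemma vmulC x y : vmul x y = vmul y x.
Proof.
have H := mt_brd (ptens y x).
rewrite rm_brdE in H; rewrite !vmulE -H -mt_FM; apply: mt_F_eq.
exact: mc_mu_comm.
Qed.

Lemma vmul1l x : vmul vone x = x.
Proof.
rewrite -[RHS]mt_lun vmulE -[RHS](mt_F_eq mc_mu_unitl) mt_FM.
by rewrite (mt_F_phi mc_eta (mc_id 1)) mt_F_id.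
Qed.

Lemma vmul_linear x : linear (vmul x).
Proof. by move=> a y z; rewrite /vmul ptens_linearr linearP. Qed.

(** Write [x] as [1 * x] and use that [m] commutes with [mu] in the first factor. *)
Lemma mt_mE x : mt_m F x = vmul vtheta x.
Proof.
have H := mt_F_eq mc_m_mul (mt_phi 1 1 (ptens vone x)).
rewrite !mt_FM (mt_F_phi mc_m) mt_F_id -!vmulE vmul1l in H.
exact: esym H.
Qed.

HB.instance Definition _ x :=
  GRing.isLinear.Build R V V *:%R (vmul x) (vmul_linear x).

Lemma frobl x y :
  mt_Delta F (vmul x y) = rm_tho (vmul x) idfun (mt_Delta F y).
Proof.
have H := mt_F_eq mc_frobl (mt_phi 1 1 (ptens x y)).
rewrite !mt_FM (mt_F_phi (mc_id 1)) mt_F_id -!vmulE -mt_DeltaE in H.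
(* The relation can only be evaluated on pure tensors, so [Delta y] is expanded into them. *)
rewrite -[LHS]mt_phiK mt_DeltaE -{}H {1 2}(tens_sum (mt_Delta F y)).
rewrite !linear_sum; apply: eq_bigr => p _; rewrite !linearZ; congr (_ *: _).
rewrite -mt_phi_asc (mt_F_phi mc_mu (mc_id 1)) mt_F_id -vmulE.
by rewrite mt_phiK rm_thoE.
Qed.

Lemma frobr x y :
  mt_Delta F (vmul x y) = rm_tho idfun (vmul y) (mt_Delta F x).
Proof.
have H := mt_F_eq mc_frobr (mt_phi 1 1 (ptens x y)).
rewrite !mt_FM (mt_F_phi mc_Delta (mc_id 1)) !mt_F_id -!vmulE -mt_DeltaE in H.
rewrite -[LHS]mt_phiK mt_DeltaE -{}H {1 2}(tens_sum (mt_Delta F x)).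
rewrite (linear_comb _ _ (linearP (mt_phi 1 1))).
rewrite (linear_comb _ _ (ptens_linearl y)) !linear_sum.
apply: eq_bigr => p _; rewrite !linearZ; congr (_ *: _).
rewrite mt_phi_asc (mt_F_phi (mc_id 1) mc_mu) mt_F_id -vmulE.
by rewrite mt_phiK rm_thoE vmulC.
Qed.

Definition copair : rm_tob V V := mt_Delta F vone.

(** One Frobenius relation pulls [x] out on the left; after writing [y] as [1 * y], the other pulls
    [y] out on the right. *)
Lemma mt_Delta_mul x y :
  mt_Delta F (vmul x y) = rm_tho (vmul x) (vmul y) copair.
Proof.
rewrite frobl -[y in LHS]vmul1l frobr -/copair.
pose f : {linear rm_tob V V -> rm_tob V V} :=
  rm_tho (vmul x) idfun \o rm_tho idfun (vmul y).
apply: (lin_basisP (f := f)) => p.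
rewrite -[LHS]/(rm_tho (vmul x) idfun (rm_tho idfun (vmul y) (bvec p))).
by rewrite !rm_tho_bvec rm_thoE.
Qed.

(** By the two Frobenius relations both sides are [Delta x]. *)
Lemma copair_slide x : rm_tho (vmul x) idfun copair = rm_tho idfun (vmul x) copair.
Proof. by rewrite -frobl -frobr vmulC. Qed.

Lemma copair_sym : rm_brd V V copair = copair.
Proof.
have H := mt_brd copair.
rewrite -[LHS]mt_phiK -H mt_DeltaE -mt_FM (mt_F_eq mc_Delta_cocomm).
by rewrite -mt_DeltaE mt_phiK.
Qed.

(** The hypothesis on the MTQFT, evaluated at the unit of [V]. *)
Lemma mt_mu_copair :
  mt_F F (mc_cmp mc_m mc_m) =1 mt_F F (mc_cmp mc_mu mc_Delta) ->
  mt_mu F copair = vmul vtheta vtheta.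
Proof.
by move/(_ vone); rewrite !mt_FM -mt_DeltaE -mt_mE.
Qed.

End FrobeniusAlgebra.

(** * Tensor powers *)

Section TensorPower.
Variables (R : comPzRingType) (V : freemod R).
Implicit Types I : finType.

Lemma eq_ptpow I (v v' : I -> V) : v =1 v' -> ptpow v = ptpow v'.
Proof.
by move=> e; apply/ffunP => x; rewrite !ffunE; apply: eq_bigr => i _; rewrite e.
Qed.

(** Multilinearity of the pure tensor: in each product of coordinates only the factor at [i]
    varies. *)
Lemma ptpow_slot I (i : I) a (v v1 v2 : I -> V) :
  v i = a *: v1 i + v2 i -> (forall k, k != i -> v1 k = v k) ->
  (forall k, k != i -> v2 k = v k) -> ptpow v = a *: ptpow v1 + ptpow v2.
Proof.
move=> vi h1 h2; apply/ffunP => x; rewrite !ffunE.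
have E (w : I -> V) : \prod_k Defs.coord (w k) (x k) =
  Defs.coord (w i) (x i) * \prod_(k | k != i) Defs.coord (w k) (x k).
  by rewrite (bigD1 i).
rewrite !{}E vi.
have -> : Defs.coord (a *: v1 i + v2 i) (x i) =
    a * Defs.coord (v1 i) (x i) + Defs.coord (v2 i) (x i).
  by rewrite linearP ffunE ffunE.
rewrite mulrDl /GRing.scale /= mulrA.
rewrite (eq_bigr _ (fun k ki => congr1 (fun z => Defs.coord z (x k)) (h1 k ki))).
by rewrite (eq_bigr _ (fun k ki => congr1 (fun z => Defs.coord z (x k)) (h2 k ki))).
Qed.

Lemma ptpow_bvec I (x : {ffun I -> bas V}) :
  bvec (x : bas (tpow V I)) = ptpow (fun i => bvec (x i)).
Proof.
apply/ffunP => y; rewrite !ffunE.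
have [->|] := eqVneq y x.
  by rewrite big1 // => i _; rewrite coord_bvec ffunE eqxx.
move=> ne; have [i nei] : exists i, y i != x i.
  apply/existsP; rewrite -negb_forall; apply: contra ne => /forallP e.
  by apply/eqP/ffunP => i; apply/eqP.
by rewrite (bigD1 i) //= coord_bvec ffunE (negPf nei) mul0r.
Qed.

(** Being the transpose of the push-forward, [bas_pull] acts on coordinates by precomposition, for
    any [phi]. *)
Lemma coord_bas_pull (U W : freemod R) (phi : bas U -> bas W) t x :
  Defs.coord (bas_pull phi t) x = Defs.coord t (phi x).
Proof.
rewrite /bas_pull /= /lin_ext linear_sum sum_ffunE (bigD1 (phi x)) //=.
rewrite linearZ /= ffunE linear_sum sum_ffunE (bigD1 x) //= coord_bvec ffunE eqxx.
rewrite big1 ?addr0 => [|y /andP[_ /negPf yx]].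
  rewrite big1 ?addr0 => [|y yx]; first by rewrite /GRing.scale /= mulr1.
  rewrite linearZ /= ffunE linear_sum sum_ffunE big1 ?scaler0 // => z /eqP zy.
  rewrite coord_bvec ffunE; case: eqP => // xz.
  by case/eqP: yx; rewrite -zy xz.
by rewrite coord_bvec ffunE eq_sym yx.
Qed.

Lemma bas_pullK (U W : freemod R) (phi : bas U -> bas W) psi :
  cancel phi psi -> cancel psi phi -> cancel (bas_pull phi) (bas_push phi).
Proof.
move=> phiK psiK t; apply: coord_inj; apply/ffunP => y.
by rewrite (coord_bas_push _ _ phiK psiK) coord_bas_pull psiK.
Qed.

End TensorPower.

Lemma big_inj_sub (T : Type) (idx : T) (op : Monoid.com_law idx)
    (I U : finType) (inj : U -> I) (P : pred I) (f : I -> T) :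
  injective inj -> (forall u, P (inj u)) ->
  (forall i, P i -> exists u, inj u = i) ->
  \big[op/idx]_(i | P i) f i = \big[op/idx]_u f (inj u).
Proof.
move=> injI injP cov; rewrite (reindex_omap inj (fun i => [pick u | inj u == i])).
  apply: eq_bigl => u; rewrite injP /=; case: pickP => [v /eqP/injI -> |/(_ u)].
    exact: eqxx.
  by rewrite eqxx.
move=> i Pi; case: pickP => [u /eqP <- //|]; have [u <-] := cov i Pi.
by move/(_ u); rewrite eqxx.
Qed.

(** * Splitting off one or two tensor factors *)

Section Factors.
Variables (R : comPzRingType) (F : MTQFT R).
Local Notation V := (mt_V F).
Variables (I U : finType) (inj : U -> I).
Hypothesis injI : injective inj.

Section One.
Variable a : I.
Hypothesis a_inj : forall u, inj u != a.
Hypothesis a_cover : forall i, i != a -> exists u, inj u = i.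

Lemma join1_ptens (v : I -> V) :
  Defs.join1 F inj a (ptens (v a) (ptpow (fun u => v (inj u)))) = ptpow v.
Proof.
apply: coord_inj; apply/ffunP => x.
rewrite coord_bas_pull coord_ptens /= !ffunE (bigD1 a) //=.
rewrite (big_inj_sub _ _ injI a_inj a_cover); congr (_ * _).
by apply: eq_bigr => u _; rewrite ffunE.
Qed.

Lemma split1_ptpow (v : I -> V) :
  Defs.split1 F inj a (ptpow v) = ptens (v a) (ptpow (fun u => v (inj u))).
Proof.
rewrite -join1_ptens.
(* The inverse of [sel1]: an index in the image of [inj] is read from the second component, and the
   only other index is [a]. *)
pose psi (t : bas (rm_tob V (tpow V U))) : bas (tpow V I) :=
  [ffun i => if [pick u | inj u == i] is Some u then t.2 u else t.1].
apply: (bas_pullK (psi := psi)).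
  move=> x; apply/ffunP => i; rewrite ffunE; case: pickP => [u /eqP <-|].
    by rewrite ffunE.
  have [-> //|ia] := eqVneq i a.
  by have [u <-] := a_cover ia; move/(_ u); rewrite eqxx.
case=> y g; congr (_, _) => /=.
  by rewrite ffunE; case: pickP => // u; rewrite (negPf (a_inj u)).
apply/ffunP => u; rewrite !ffunE; case: pickP => [u' /eqP/injI -> //|].
by move/(_ u); rewrite eqxx.
Qed.
End One.

Section Two.
Variables a b : I.
Hypothesis ab : a != b.
Hypothesis a_inj : forall u, inj u != a.
Hypothesis b_inj : forall u, inj u != b.
Hypothesis ab_cover : forall i, i != a -> i != b -> exists u, inj u = i.

Lemma join2_ptens (v : I -> V) :
  Defs.join2 F inj a b (ptens (ptens (v a) (v b)) (ptpow (fun u => v (inj u)))) =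
  ptpow v.
Proof.
apply: coord_inj; apply/ffunP => x.
rewrite coord_bas_pull coord_ptens /= !ffunE (bigD1 a) //= (bigD1 b) 1?eq_sym //=.
rewrite mulrA.
rewrite (big_inj_sub (P := fun i => (i != a) && (i != b)) _ _ injI); first last.
- by move=> i /andP[]; exact: ab_cover.
- by move=> u; rewrite a_inj b_inj.
by congr (_ * _); apply: eq_bigr => u _; rewrite ffunE.
Qed.

Lemma split2_ptpow (v : I -> V) :
  Defs.split2 F inj a b (ptpow v) =
  ptens (ptens (v a) (v b)) (ptpow (fun u => v (inj u))).
Proof.
rewrite -join2_ptens.
pose psi (t : bas (rm_tob (rm_tob V V) (tpow V U))) : bas (tpow V I) :=
  [ffun i => if [pick u | inj u == i] is Some u then t.2 u else
             if i == a then t.1.1 else t.1.2].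
apply: (bas_pullK (psi := psi)).
  move=> x; apply/ffunP => i; rewrite ffunE; case: pickP => [u /eqP <-|].
    by rewrite ffunE.
  have [-> //|ia] := eqVneq i a; have [-> //|ib] := eqVneq i b.
  by have [u <-] := ab_cover ia ib; move/(_ u); rewrite eqxx.
case=> [[y z] g]; congr ((_, _), _) => /=.
- rewrite ffunE; case: pickP => [u|_]; first by rewrite (negPf (a_inj u)).
  by rewrite eqxx.
- rewrite ffunE; case: pickP => [u|_]; first by rewrite (negPf (b_inj u)).
  by rewrite eq_sym (negPf ab).
apply/ffunP => u; rewrite !ffunE; case: pickP => [u' /eqP/injI -> //|].
by move/(_ u); rewrite eqxx.
Qed.
End Two.
End Factors.

(** * Changing two arcs of a partition into circles *)

(** Induction on the size of [A], removing an orbit [{x, f x}] at a time. *)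
Lemma even_card_invol (T : finType) (f : T -> T) (A : {set T}) :
  {in A, forall x, [/\ f x \in A, f (f x) = x & f x != x]} -> ~~ odd #|A|.
Proof.
have [n] := ubnP #|A|; elim: n A => // n IHn A ltAn fA.
have [->|[x xA]] := set_0Vmem A; first by rewrite cards0.
have [fxA ffx fxx] := fA x xA.
have cA : #|A| = #|A :\ x :\ f x|.+2.
  by rewrite (cardsD1 x A) xA (cardsD1 (f x) (A :\ x)) !inE fxx fxA.
rewrite cA /= negbK; apply: IHn; first by move: ltAn; rewrite cA ltnS; apply: ltnW.
move=> y; rewrite !inE => /and3P[yfx yx yA]; have [fyA ffy fyy] := fA y yA.
split=> //; rewrite fyA andbT; apply/andP; split.
  by apply: contra yx => /eqP e; rewrite -ffy e ffx.
by apply: contra yfx => /eqP <-; rewrite ffy.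
Qed.

Section Equivalences.
Variable T : finType.
Implicit Types (e : rel T) (E : {set T}).

Definition is_equiv e := [/\ reflexive e, symmetric e & transitive e].

(** When [e] is an equivalence, this is the equivalence generated by [e] and [(a, b)]: the classes
    of [a] and [b] are joined. *)
Definition add_pair e a b : rel T :=
  fun x y => [|| e x y, e x a && e b y | e x b && e a y].

(* How the partition into circles changes when the two arcs with ends [E] are
   replaced by two others.  The integer is the change in the number of circles,
   and [p] and [q] are ends on distinct circles on the side with two circles. *)
Variant saddle E ea eb : int -> T -> T -> Prop :=
| Merge p q of p \in E & q \in E & ~~ ea p q &
    (forall x, x \in E -> ea p x || ea q x) & eb =2 add_pair ea p q :
    saddle E ea eb (-1) p q
| Split p q of p \in E & q \in E & ~~ eb p q &
    (forall x, x \in E -> eb p x || eb q x) & ea =2 add_pair eb p q :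
    saddle E ea eb 1 p q
| Twist p of p \in E & (forall x, x \in E -> ea p x) & eb =2 ea :
    saddle E ea eb 0 p p.

Section Saddle.
Variable e : rel T.
Hypothesis eE : is_equiv e.
Let e_refl : reflexive e. Proof. by case: eE. Qed.
Let e_sym : symmetric e. Proof. by case: eE. Qed.
Let e_trans : transitive e. Proof. by case: eE. Qed.

(** Class functions turn statements about [e] into equations, which [congruence] can then settle. *)
Lemma equiv_classP : exists r : T -> {set T}, forall x y, e x y <-> r x = r y.
Proof.
exists (fun x => [set y | e x y]) => x y; split=> [exy|].
  apply/setP => z; rewrite !inE; apply/idP/idP; last exact: e_trans.
  by apply: e_trans; rewrite e_sym.
by move/setP/(_ y); rewrite !inE e_refl.
Qed.

Lemma add_pairP a b x y :
  reflect (e x y \/ (e x a /\ e b y \/ e x b /\ e a y)) (add_pair e a b x y).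
Proof.
apply: (iffP or3P) => [[|/andP|/andP]|[|[/andP|/andP]]]; try tauto.
- by move=> h; apply: Or31.
- by move=> h; apply: Or32.
- by move=> h; apply: Or33.
Qed.

Lemma add_pair_equiv a b : is_equiv (add_pair e a b).
Proof.
have [r rP] := equiv_classP.
split=> [x|x y|y x z].
- by rewrite /add_pair e_refl.
- apply/idP/idP => /add_pairP[/rP exy|[[/rP xa /rP yb]|[/rP xb /rP ya]]];
    apply/add_pairP; [left|right; right|right; left|left|right; right|right; left];
    do ?split; apply/rP; congruence.
- move=> /add_pairP[/rP ?|[[/rP ? /rP ?]|[/rP ? /rP ?]]];
    move=> /add_pairP[/rP ?|[[/rP ? /rP ?]|[/rP ? /rP ?]]]; apply/add_pairP;
    first [ by left; apply/rP; congruence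
          | by right; left; split; apply/rP; congruence
          | by right; right; split; apply/rP; congruence].
Qed.

Lemma add_pair_id a b : e a b -> add_pair e a b =2 e.
Proof.
move=> eab x y; apply/add_pairP/idP; last by left.
case=> [//|[[xa by_]|[xb ay]]]; first exact: e_trans (e_trans xa eab) by_.
by rewrite e_sym in eab; exact: e_trans (e_trans xb eab) ay.
Qed.

Lemma add_pair_sub a b x y : e x y -> add_pair e a b x y.
Proof. by move=> exy; apply/add_pairP; left. Qed.

Lemma add_pair_pair a b : add_pair e a b a b.
Proof. by apply/add_pairP; right; left; rewrite !e_refl. Qed.

End Saddle.

Lemma eq_add_pair e e' a b : e =2 e' -> add_pair e a b =2 add_pair e' a b.
Proof. by move=> ee x y; rewrite /add_pair !ee. Qed.

(** By parity each point shares its class with another one, and the remaining two points cannot lie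
    in separate classes. The proof is a truth table in the six relations; every other row violates a
    parity or transitivity. *)
Lemma pairing e p1 p2 p3 p4 : is_equiv e -> uniq [:: p1; p2; p3; p4] ->
  (forall x, x \in [:: p1; p2; p3; p4] ->
     ~~ odd #|[set y in [:: p1; p2; p3; p4] | e x y]|) ->
  [\/ e p1 p3 && e p2 p4, e p1 p4 && e p2 p3 | e p1 p2 && e p3 p4].
Proof.
move=> eE u par; have [e_refl e_sym e_trans] := eE.
have card x : #|[set y in [:: p1; p2; p3; p4] | e x y]| =
    (e x p1 + (e x p2 + (e x p3 + e x p4)))%N.
  rewrite (eq_card (B := [in [seq y <- [:: p1; p2; p3; p4] | e x y]])); last first.
    by move=> y; rewrite !inE mem_filter !inE andbC.
  by rewrite (card_uniqP (filter_uniq _ u)) size_filter /= addn0.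
have := par p1; have := par p2; have := par p3; have := par p4.
rewrite !card !inE !eqxx ?orbT !e_refl.
rewrite (e_sym p2 p1) (e_sym p3 p1) (e_sym p4 p1) (e_sym p3 p2) (e_sym p4 p2) (e_sym p4 p3).
have := @e_trans p1 p2 p3; have := @e_trans p2 p1 p3; have := @e_trans p3 p1 p2.
have := @e_trans p4 p1 p2.
rewrite (e_sym p2 p1) (e_sym p3 p2) (e_sym p4 p2).
case: (e p1 p2); case: (e p1 p3); case: (e p1 p4); case: (e p2 p3);
  case: (e p2 p4); case: (e p3 p4) => //= t1 t2 t3 t4 q1 q2 q3 q4;
  try (by [constructor 1 | constructor 2 | constructor 3]);
  try (by move: (q1 isT)); try (by move: (q2 isT)); try (by move: (q3 isT));
  try (by move: (q4 isT)); try (by move: (t1 isT isT)); try (by move: (t2 isT isT));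
  try (by move: (t3 isT isT)); try (by move: (t4 isT isT)).
Qed.

(** Here [e] is the partition with the matching edge cut out, to which each smoothing adds two arcs.
    The way [e] itself pairs up the four ends decides the kind of saddle. *)
Lemma saddleP e ea eb p1 p2 p3 p4 : is_equiv e -> uniq [:: p1; p2; p3; p4] ->
  (forall x, x \in [:: p1; p2; p3; p4] ->
     ~~ odd #|[set y in [:: p1; p2; p3; p4] | e x y]|) ->
  ea =2 add_pair (add_pair e p1 p3) p2 p4 -> eb =2 add_pair (add_pair e p1 p4) p2 p3 ->
  exists t p q, saddle [set x in [:: p1; p2; p3; p4]] ea eb t p q.
Proof.
move=> eE u par eaE ebE; have [e_refl e_sym e_trans] := eE.
set E := [set x in _].
have pE : [/\ p1 \in E, p2 \in E, p3 \in E & p4 \in E].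
  by rewrite !inE !eqxx !orbT.
have EP (P : T -> Prop) : P p1 -> P p2 -> P p3 -> P p4 -> forall x, x \in E -> P x.
  by move=> P1 P2 P3 P4 x; rewrite !inE => /or4P[] /eqP ->.
have [p1E p2E p3E p4E] := pE.
case: (pairing eE u par) => /andP[e1 e2].
(* The 0-arcs join points already joined by [e], and the 1-arcs join two classes of [e]: a merge, or
   a twist if these coincide. *)
- have ea_e : ea =2 e.
    move=> x y; rewrite eaE (eq_add_pair _ _ (add_pair_id eE e1)).
    by rewrite (add_pair_id eE e2).
  have eb_e : eb =2 add_pair e p1 p4.
    move=> x y; rewrite ebE (add_pair_id (add_pair_equiv eE _ _)) //.
    apply/(add_pairP _ _ _ _); right; right; split=> //; by rewrite e_sym.
  case: (boolP (e p1 p4)) => [e3|ne3].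
    exists 0, p1, p1; apply: Twist => //; last first.
      by move=> x y; rewrite ea_e eb_e add_pair_id.
    apply: EP; rewrite ea_e //.
    by apply: e_trans e3 _; rewrite e_sym.
  exists (-1), p1, p4; apply: Merge => //; first by rewrite ea_e.
    by apply: EP; rewrite !ea_e ?e_refl ?e1 ?orbT // (e_sym p4) e2 orbT.
  by move=> x y; rewrite eb_e -(eq_add_pair _ _ ea_e).
(* Symmetrically, the 1-arcs are redundant: a split, or a twist. *)
- have eb_e : eb =2 e.
    move=> x y; rewrite ebE (eq_add_pair _ _ (add_pair_id eE e1)).
    by rewrite (add_pair_id eE e2).
  have ea_e : ea =2 add_pair e p1 p3.
    move=> x y; rewrite eaE (add_pair_id (add_pair_equiv eE _ _)) //.
    apply/(add_pairP _ _ _ _); right; right; split=> //; by rewrite e_sym.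
  case: (boolP (e p1 p3)) => [e3|ne3].
    exists 0, p1, p1; apply: Twist => //; last first.
      by move=> x y; rewrite ea_e eb_e add_pair_id.
    apply: EP; rewrite ea_e add_pair_id //.
    by apply: e_trans e3 _; rewrite e_sym.
  exists 1, p1, p3; apply: Split => //; first by rewrite eb_e.
    by apply: EP; rewrite !eb_e ?e_refl ?e1 ?orbT // (e_sym p3) e2 orbT.
  by move=> x y; rewrite ea_e -(eq_add_pair _ _ eb_e).
(* Both top ends lie in one class and both bottom ends in one, so either smoothing joins the same
   two classes: a twist. *)
- have ea_e : ea =2 add_pair e p1 p3.
    move=> x y; rewrite eaE (add_pair_id (add_pair_equiv eE _ _)) //.
    by apply/(add_pairP _ _ _ _); right; left; rewrite e_sym.
  have eb_e : eb =2 add_pair e p1 p4.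
    move=> x y; rewrite ebE (add_pair_id (add_pair_equiv eE _ _)) //.
    by apply/(add_pairP _ _ _ _); right; left; rewrite e_sym (e_sym p4).
  exists 0, p1, p1; apply: Twist => //.
    apply: EP; rewrite ea_e; apply/(add_pairP _ _ _ _).
    + by left.
    + by left.
    + by right; left.
    + by right; left.
  move=> x y; rewrite ea_e eb_e; have [r rP] := equiv_classP eE.
  move/rP: e2 => e2.
  apply/idP/idP => /(add_pairP _ _ _ _)[/rP exy|[[/rP xp /rP yp]|[/rP xp /rP yp]]];
    apply/add_pairP; [left|right; left|right; right|left|right; left|right; right];
    do ?split; apply/rP; congruence.
Qed.

End Equivalences.

(** * Circles of the states of a trivalent perfect matching graph *)

Lemma connect_add_pair (T : finType) (r r0 : rel T) (a b c d : T) :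
  symmetric r0 ->
  (forall x y, r x y = [|| r0 x y, ((x, y) \in [:: (a, b); (b, a)])
                        | ((x, y) \in [:: (c, d); (d, c)])]) ->
  connect r =2 add_pair (add_pair (connect r0) a b) c d.
Proof.
move=> s0 rE.
have e0 : is_equiv (connect r0).
  by split=> [x|x y|]; [exact: connect0 | exact: sym_connect_sym | exact: connect_trans].
have e1 := add_pair_equiv e0 a b; have [e2r e2s e2t] := add_pair_equiv e1 c d.
have sr : connect_sym r.
  apply: sym_connect_sym => x y; rewrite !rE s0 !inE !xpair_eqE; congr (_ || _).
  by rewrite ![(x == _) && _]andbC; congr (_ || _); rewrite orbC.
have sub x y : connect r0 x y -> connect r x y.
  by apply: connect_sub => {}x {}y r0xy; apply: connect1; rewrite rE r0xy.
have rab : connect r a b by apply: connect1; rewrite rE !inE eqxx !orbT.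
have rcd : connect r c d by apply: connect1; rewrite rE !inE eqxx !orbT.
have rba : connect r b a by rewrite sr.
have rdc : connect r d c by rewrite sr.
have sub1 x y : add_pair (connect r0) a b x y -> connect r x y.
  case/add_pairP => [/sub //|[[/sub xa /sub by_]|[/sub xb /sub ay]]].
    exact: connect_trans (connect_trans xa rab) by_.
  exact: connect_trans (connect_trans xb rba) ay.
move=> x y; apply/idP/idP; last first.
  case/add_pairP => [/sub1 //|[[/sub1 xc /sub1 dy]|[/sub1 xd /sub1 cy]]].
    exact: connect_trans (connect_trans xc rcd) dy.
  exact: connect_trans (connect_trans xd rdc) cy.
(* Induction on a path, each step being an old edge or one of the two new ones in some direction. *)
case/connectP => s; elim: s x => [|z s IHs] x /= => [_ -> //|/andP[rxz]].
move=> /IHs{}IHs /IHs; apply: e2t.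
move: rxz; rewrite rE !inE !xpair_eqE => /or3P[r0xz|/orP[]/andP[/eqP-> /eqP->]|/orP[]/andP[/eqP-> /eqP->]].
- by do 2!apply: add_pair_sub; apply: connect1.
- by apply: add_pair_sub; apply: add_pair_pair.
- by apply: add_pair_sub; case: e1 => _ -> _; apply: add_pair_pair.
- by apply: add_pair_pair.
- by rewrite e2s; apply: add_pair_pair.
Qed.

Section Ribbon.
Variables (Gm : ribbon) (M : matching Gm) (hGm : trivalent Gm).
Local Notation H := (Defs.half Gm).
Local Notation nx := (nxt Gm).
Local Notation fl := (@Defs.flip Gm).
Implicit Types (x y z h : H) (j k : 'I_(msize M)) (al be : state M).

Lemma porbit_nx x : porbit nx x =i [:: x; nx x; nx (nx x)].
Proof.
by move=> y; rewrite porbit_traject hGm //; apply: imset_f.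
Qed.

Lemma nx3 x : nx (nx (nx x)) = x.
Proof. by have := iter_porbit nx x; rewrite hGm //; apply: imset_f. Qed.

Lemma nx_uniq x : uniq [:: x; nx x; nx (nx x)].
Proof. by have := uniq_traject_porbit nx x; rewrite hGm //; apply: imset_f. Qed.

Lemma medgeE j h : h \in medge j -> medge j = [set h; fl h].
Proof.
have /imsetP[k _ ->] := medge_edge j.
by rewrite !inE => /orP[]/eqP-> //; rewrite flipK setUC.
Qed.

Lemma medge_flip j h : h \in medge j -> fl h \in medge j.
Proof. by move=> hj; rewrite (medgeE hj) !inE eqxx orbT. Qed.

Lemma incident_medge j x h : h \in medge j -> h \in porbit nx x ->
  incident (porbit nx x) (medge j).
Proof. by move=> hj hx; apply/set0Pn; exists h; rewrite inE hj hx. Qed.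

(** A vertex meets one matching edge only, and it cannot contain both half-edges of that edge, whose
    endpoints are distinct. *)
Lemma medge_uniq j j' h h' : h \in medge j -> h' \in medge j' ->
  h' \in porbit nx h -> h' = h /\ j' = j.
Proof.
move=> hj hj' hh.
have [k [_ uk]] := medge_perfect M (imset_f (porbit nx) (isT : h \in predT)).
have jk := uk _ (incident_medge hj (porbit_id _ _)).
have jk' := uk _ (incident_medge hj' hh).
subst j j'; split=> //.
move: hj'; rewrite (medgeE hj) !inE => /orP[/eqP //|/eqP h'E].
by have := medge_ends hj; rewrite -h'E eq_sym eq_porbit_mem hh.
Qed.

Lemma medge_exists x : exists j h, h \in medge (m := M) j /\ h \in porbit nx x.
Proof.
have [k [/set0Pn[h]]] := medge_perfect M (imset_f (porbit nx) (isT : x \in predT)).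
by rewrite inE => /andP[hx hk] _; exists k, h.
Qed.

(** The vertex of [x] carries one matched half-edge [h], and trivalence leaves [nx h] and
    [nx (nx h)] as its other half-edges. *)
Lemma unmatchedP x : reflect (exists j h, h \in medge (m := M) j /\
  (x = nx h \/ x = nx (nx h))) (x \in unmatched M).
Proof.
rewrite inE; apply: (iffP forallP) => [nx_x|[j [h [hj xE]]] k].
  have [j [h [hj]]] := medge_exists x.
  rewrite porbit_nx !inE => /or3P[]/eqP hE.
  - by move: (nx_x j); rewrite -hE hj.
  - by exists j, h; split=> //; right; rewrite hE nx3.
  - by exists j, h; split=> //; left; rewrite hE nx3.
apply/negP => xk; have [] := medge_uniq hj xk.
  by rewrite porbit_nx !inE; case: xE => ->; rewrite eqxx ?orbT.
move=> xh; have := nx_uniq h; rewrite /= !inE.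
by case: xE => <-; rewrite xh eqxx ?orbT.
Qed.

Lemma unmatched_flip x : (fl x \in unmatched M) = (x \in unmatched M).
Proof.
rewrite !inE; apply/forallP/forallP => Hx j; have := Hx j; apply: contra => /medge_flip //.
by rewrite flipK.
Qed.

(** The order is up-left, up-right, down-left, down-right, as [saddleP] expects its four points. *)
Lemma endsE j h : h \in medge (m := M) j ->
  ends j = [set x in [:: nx (nx h); nx h; nx (fl h); nx (nx (fl h))]].
Proof.
move=> hj; rewrite /ends (medgeE hj).
rewrite bigcup_setU !big_set1; apply/setP => x; rewrite !inE.
by rewrite -!orbA; case: (x == nx h); rewrite ?orbT.
Qed.

Lemma endsP j x :
  reflect (exists2 h, h \in medge j & x = nx h \/ x = nx (nx h)) (x \in ends (M := M) j).
Proof.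
apply: (iffP bigcupP) => -[h hj]; first by rewrite !inE => /orP[]/eqP; exists h; auto.
by case=> ->; exists h => //; rewrite !inE eqxx ?orbT.
Qed.

Lemma ends_unmatched j x : x \in ends j -> x \in unmatched M.
Proof. by case/endsP => h hj xE; apply/unmatchedP; exists j, h. Qed.

Lemma ends_uniq j h : h \in medge (m := M) j ->
  uniq [:: nx (nx h); nx h; nx (fl h); nx (nx (fl h))].
Proof.
move=> hj; have ne := medge_ends hj.
have d u v : u \in porbit nx h -> v \in porbit nx (fl h) -> u != v.
  move=> uh vh; apply: contra ne => /eqP uv; rewrite eq_porbit_mem porbit_sym.
  move: uh vh; rewrite uv -!eq_porbit_mem => /eqP <- /eqP <-; exact: eqxx.
have i u : [/\ u \in porbit nx u, nx u \in porbit nx u & nx (nx u) \in porbit nx u].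
  by rewrite !porbit_nx !inE !eqxx !orbT.
have [_ h1 h2] := i h; have [_ f1 f2] := i (fl h).
rewrite /= !inE !negb_or (d _ _ h2 f1) (d _ _ h2 f2) (d _ _ h1 f1) (d _ _ h1 f2).
have := nx_uniq h; have := nx_uniq (fl h); rewrite /= !inE !negb_or !andbT.
by case/andP=> _ -> /andP[_ n1]; rewrite eq_sym n1.
Qed.

Section Arcs.
Variables (al : state M) (j : 'I_(msize M)).

(** The arcs at all matching edges other than [e_j]; with the flips they give the strands left when
    [e_j] is cut out. *)
Definition arc_off x y : bool :=
  [exists k, (k != j) && [exists h in medge k, Defs.arc (al k) h x y]].

Definition adj_off x y : bool := (y == fl x) || arc_off x y.

(** Turning the picture of the edge upside down preserves both smoothings. This makes adjacency
    symmetric. *)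
Lemma arc_flip b h x y : Defs.arc b (fl h) x y = Defs.arc b h y x.
Proof.
rewrite /Defs.arc flipK; case: b; first by rewrite ![(x == _) && _]andbC.
by rewrite ![(x == _) && _]andbC orbC.
Qed.

Lemma arc_porbit b h x y : Defs.arc b h x y ->
  [/\ h \in porbit nx x, fl h \in porbit nx y & x = nx h \/ x = nx (nx h)].
Proof.
have mem h' : h' \in porbit nx (nx h') /\ h' \in porbit nx (nx (nx h')).
  by split; rewrite porbit_sym porbit_nx !inE eqxx !orbT.
have [m1 m2] := mem h; have [m3 m4] := mem (fl h).
by rewrite /Defs.arc; case: b => /orP[]/andP[/eqP -> /eqP ->]; split; auto.
Qed.

Lemma arc_exists b h x : x = nx h \/ x = nx (nx h) -> exists y, Defs.arc b h x y.
Proof.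
case=> ->; rewrite /Defs.arc eqxx.
  exists (if b then nx (fl h) else nx (nx (fl h))).
  by case: b; rewrite eqxx !orbT.
exists (if b then nx (nx (fl h)) else nx (fl h)).
by case: b; rewrite eqxx.
Qed.

Lemma arc_fun b h x y z : Defs.arc b h x y -> Defs.arc b h x z -> y = z.
Proof.
have := nx_uniq h; rewrite /= !inE !negb_or => /andP[_ /andP[/negPf n _]].
by rewrite /Defs.arc; case: b => /orP[]/andP[/eqP -> /eqP ->]; rewrite ?n ?[_ == nx h]eq_sym ?n ?eqxx //=
  ?orbF => /eqP.
Qed.

Lemma adj_off_sym : symmetric adj_off.
Proof.
move=> x y; rewrite /adj_off; congr (_ || _).
  by rewrite eq_sym (can2_eq (@flipK Gm) (@flipK Gm)).
apply: eq_existsb => k; congr (_ && _).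
by apply/existsP/existsP => -[h /andP[hk ha]]; exists (fl h);
  rewrite medge_flip // arc_flip.
Qed.

Lemma adjE h : h \in medge j -> adj al =2 fun x y =>
  [|| adj_off x y, Defs.arc (al j) h x y | Defs.arc (al j) h y x].
Proof.
move=> hj x y; rewrite /adj /adj_off -orbA; congr (_ || _).
apply/existsP/idP => [[k /existsP[h' /andP[h'k ha]]]|].
  have [kj|kj] := eqVneq k j.
    move: h'k ha; rewrite kj (medgeE hj) !inE => /orP[]/eqP->; first by move->; rewrite orbT.
    by rewrite arc_flip => ->; rewrite !orbT.
  apply/orP; left; apply/existsP; exists k; rewrite kj /=.
  by apply/existsP; exists h'; rewrite h'k.
case/or3P=> [/existsP[k /andP[_ hk]]|ha|ha]; first by exists k.
  by exists j; apply/existsP; exists h; rewrite hj.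
by exists j; apply/existsP; exists (fl h); rewrite medge_flip // arc_flip.
Qed.

Lemma arc_off_unmatched x y : arc_off x y -> (x \in unmatched M) && (y \in unmatched M).
Proof.
case/existsP=> k /andP[_ /existsP[h /andP[hk ha]]].
apply/andP; split; apply/unmatchedP.
  by exists k, h; split=> //; have [] := arc_porbit ha.
exists k, (fl h); split; first exact: medge_flip.
by move: ha; rewrite -arc_flip => /arc_porbit[].
Qed.

(** Such an [x] sits at an endpoint of a unique matching edge [e_k] with [k != j], whose smoothing
    carries exactly one arc from [x], ending at the other endpoint of [e_k]. *)
Lemma arc_offP x : x \in unmatched M -> x \notin ends j ->
  exists y, [/\ arc_off x y, y \notin ends j, y != x &
    forall z, arc_off x z -> z = y].
Proof.
case/unmatchedP=> k [h [hk xE]] xj.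
have kj : k != j by apply: contra xj => /eqP <-; apply/endsP; exists h.
have [y hy] := arc_exists (al k) xE; exists y.
have [h1 h2 _] := arc_porbit hy.
split.
- by apply/existsP; exists k; rewrite kj; apply/existsP; exists h; rewrite hk.
- apply: contra kj => /endsP[h' h'j yE].
  have h'y : h' \in porbit nx (fl h).
    move: h2; rewrite -eq_porbit_mem => /eqP ->; rewrite porbit_sym porbit_nx !inE.
    by case: yE => ->; rewrite eqxx ?orbT.
  by have [_ ->] := medge_uniq (medge_flip hk) h'j h'y.
- apply: contra (medge_ends hk) => /eqP yx.
  by move: h1 h2; rewrite yx -!eq_porbit_mem => /eqP -> /eqP ->.
move=> z /existsP[k' /andP[_ /existsP[h' /andP[h'k hz]]]].
have [h3 _ _] := arc_porbit hz.
have h'h : h' \in porbit nx h.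
  by move: h1 h3; rewrite -!eq_porbit_mem => /eqP -> /eqP ->.
have [h'E kE] := medge_uniq hk h'k h'h; subst h' k'.
exact: arc_fun hz hy.
Qed.

Lemma adj_off_unmatched x y : adj_off x y -> (x \in unmatched M) = (y \in unmatched M).
Proof.
case/orP=> [/eqP ->|/arc_off_unmatched/andP[-> ->] //].
by rewrite unmatched_flip.
Qed.

(* The class [C] of [x] is stable under [flip], and [C] minus the ends under the
   arcs away from [e_j]; both are fixed-point free involutions. *)
Lemma even_ends x : x \in ends j ->
  ~~ odd #|[set y in ends j | connect adj_off x y]|.
Proof.
move=> xj; pose C := [set y | connect adj_off x y].
have e_sym := sym_connect_sym adj_off_sym.
have CU y : y \in C -> y \in unmatched M.
  rewrite inE => xy; rewrite -(closed_connect _ xy) ?(ends_unmatched xj) //.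
  exact: adj_off_unmatched.
have Cadj y z : y \in C -> adj_off y z -> z \in C.
  by rewrite !inE => xy yz; exact: connect_trans xy (connect1 yz).
have evC : ~~ odd #|C|.
  apply: (even_card_invol (f := fl)) => y yC; rewrite flipK flip_neq; split=> //.
  by apply: Cadj yC _; rewrite /adj_off eqxx.
have evD : ~~ odd #|C :\: ends j|.
  (* The default [y] is never taken on [C :\: ends j], where an arc exists. *)
  pose f y := odflt y [pick z | arc_off y z].
  have fE y z : y \in unmatched M -> y \notin ends j -> arc_off y z -> f y = z.
    move=> yU yj yz; have [w [_ _ _ u]] := arc_offP yU yj.
    rewrite /f; case: pickP => [t yt /=|/(_ z)]; last by rewrite yz.
    by rewrite (u _ yz) (u _ yt).
  have arc_sym y z : arc_off y z = arc_off z y.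
    apply: eq_existsb => k; congr (_ && _).
    by apply/existsP/existsP => -[h /andP[hk ha]]; exists (fl h);
      rewrite medge_flip // arc_flip.
  apply: (even_card_invol (f := f)) => y; rewrite inE => /andP[yj yC].
  have [z [yz zj zy _]] := arc_offP (CU _ yC) yj.
  have zC : z \in C by apply: Cadj yC _; rewrite /adj_off yz orbT.
  rewrite (fE y z) ?CU // inE zj zC; split=> //.
  by apply: fE => //; [exact: CU | rewrite arc_sym].
have -> : [set y in ends j | connect adj_off x y] = C :&: ends j.
  by apply/setP => y; rewrite !inE andbC.
by move: evC; rewrite -(cardsID (ends j) C) oddD (negPf evD) addbF.
Qed.

End Arcs.

Lemma step_saddle al be j : step al be j ->
  exists t p q, saddle (ends j) (connect (adj al)) (connect (adj be)) t p q.
Proof.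
case/andP=> alj /eqP beE.
have /imsetP[h _ hE] := medge_edge j.
have hj : h \in medge j by rewrite hE !inE eqxx.
have bej : be j by rewrite beE ffunE eqxx.
(* The two states agree at every other matching edge, so cutting out [e_j] gives the same
   strands. *)
have off : adj_off be j =2 adj_off al j.
  move=> x y; congr (_ || _); apply: eq_existsb => k.
  by case: (eqVneq k j) => //= kj; rewrite beE ffunE (negPf kj).
rewrite (endsE hj).
apply: (saddleP (e := connect (adj_off al j))).
- split; [exact: connect0 | exact/sym_connect_sym/adj_off_sym | exact: connect_trans].
- exact: (ends_uniq hj).
- move=> x xE; have xj : x \in ends j by rewrite (endsE hj) inE.
  have -> : [set y in [:: nx (nx h); nx h; nx (fl h); nx (nx (fl h))] |
      connect (adj_off al j) x y] = [set y in ends j | connect (adj_off al j) x y].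
    by apply/setP => y; rewrite (endsE hj) !inE.
  exact: even_ends.
- apply: connect_add_pair; first exact: adj_off_sym.
  move=> x y; rewrite (adjE al hj) (negPf alj) /Defs.arc !inE !xpair_eqE.
  by case: (adj_off _ _ _ _) => //=; rewrite ![(y == _) && _]andbC;
  do !case: (_ == _).
apply: connect_add_pair; first exact: adj_off_sym.
move=> x y; rewrite (adjE be hj) bej off /Defs.arc !inE !xpair_eqE.
case: (adj_off _ _ _ _) => //=; rewrite ![(y == _) && _]andbC; do !case: (_ == _) => //.
Qed.

Lemma circleP al c : reflect (exists2 x, x \in unmatched M &
  c = [set y | connect (adj al) x y]) (c \in circles al).
Proof. by apply: (iffP imsetP). Qed.

Lemma adj_equiv al : is_equiv (connect (adj al)).
Proof.
split; [exact: connect0 | apply: sym_connect_sym | exact: connect_trans].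
move=> x y; rewrite /adj; congr (_ || _).
  by rewrite eq_sym (can2_eq (@flipK Gm) (@flipK Gm)).
apply: eq_existsb => k.
by apply/existsP/existsP => -[h /andP[hk ha]]; exists (fl h);
  rewrite medge_flip // arc_flip.
Qed.

End Ribbon.

(** * Affected and unaffected circles, and the number of circles *)

Section Circles.
Variables (Gm : ribbon) (M : matching Gm) (hGm : trivalent Gm).
Local Notation H := (Defs.half Gm).
Implicit Types (x y : H) (j : 'I_(msize M)) (al be : state M).

Lemma circle_of al x : x \in unmatched M ->
  exists c : circle al, val c = [set y | connect (adj al) x y].
Proof.
move=> xU; have cP : [set y | connect (adj al) x y] \in circles al by apply: imset_f.
by exists (exist (fun c => c \in circles al) _ cP).
Qed.

Lemma circle_class al (c : circle al) x : x \in val c ->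
  val c = [set y | connect (adj al) x y].
Proof.
have [z zU ->] := imsetP (valP c); have [r s t] := adj_equiv al.
rewrite inE => zx; apply/setP => y; rewrite !inE; apply/idP/idP; last exact: t.
by apply: t; rewrite s.
Qed.

Lemma mem_circle al (c : circle al) x y : x \in val c ->
  (y \in val c) = connect (adj al) x y.
Proof. by move=> /circle_class ->; rewrite inE. Qed.

Lemma circle_neq0 al (c : circle al) : exists x, x \in val c.
Proof.
have [z zU ->] := imsetP (valP c); exists z; rewrite inE; exact: connect0.
Qed.

Lemma circle_eq al (c d : circle al) x : x \in val c -> x \in val d -> c = d.
Proof. by move=> /circle_class xc /circle_class xd; apply: val_inj; rewrite xc xd. Qed.

Lemma mem_affected al j (c : circle al) :
  reflect (exists2 x, x \in val c & x \in ends j) (c \in affected al j).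
Proof.
rewrite /affected in_set; apply: (iffP (set0Pn _)) => [[x /setIP[xc xj]]|[x xc xj]]; exists x => //.
exact/setIP.
Qed.

Lemma common_inl_inj al be j : injective (@common_inl _ _ al be j).
Proof. by move=> u v /(congr1 val) /= uv; apply: val_inj. Qed.

Lemma common_inr_inj al be j : injective (@common_inr _ _ al be j).
Proof. by move=> u v /(congr1 val) /= uv; apply: val_inj. Qed.

Lemma common_inl_unaffected al be j (u : common al be j) :
  common_inl u \notin affected al j.
Proof. by rewrite /affected in_set negbK; case/and3P: (valP u). Qed.

Lemma common_inr_unaffected al be j (u : common al be j) :
  common_inr u \notin affected be j.
Proof. by rewrite /affected in_set negbK; case/and3P: (valP u). Qed.

Section Saddle.
Variables (al be : state M) (j : 'I_(msize M)) (t : int) (p q : H).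
Hypothesis sad : saddle (ends j) (connect (adj al)) (connect (adj be)) t p q.

Lemma saddle_ends : p \in ends j /\ q \in ends j.
Proof. by case: sad. Qed.

(** The two partitions differ only by joining the classes of [p] and [q], both of which are ends. *)
Lemma saddle_off x : (forall y, y \in ends j -> ~~ connect (adj al) x y) ->
  connect (adj al) x =1 connect (adj be) x.
Proof.
have [pj qj] := saddle_ends.
move=> off y; have [r s tr] := adj_equiv be.
case: sad pj qj off => [p' q' _ _ _ _ e|p' q' _ _ _ _ e|p' _ _ e] pj qj off.
- by rewrite e /add_pair (negPf (off _ pj)) (negPf (off _ qj)) /= orbF.
- have h z : z \in ends j -> connect (adj be) x z = false.
    by move=> /off; rewrite e; apply: contraNF; apply: add_pair_sub.
  by rewrite e /add_pair (h _ pj) (h _ qj) /= orbF.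
by rewrite e.
Qed.

Lemma saddle_off' x : (forall y, y \in ends j -> ~~ connect (adj be) x y) ->
  connect (adj be) x =1 connect (adj al) x.
Proof.
have [pj qj] := saddle_ends.
move=> off y.
case: sad pj qj off => [p' q' _ _ _ _ e|p' q' _ _ _ _ e|p' _ _ e] pj qj off.
- have h z : z \in ends j -> connect (adj al) x z = false.
    by move=> /off; rewrite e; apply: contraNF; apply: add_pair_sub.
  by rewrite e /add_pair (h _ pj) (h _ qj) /= orbF.
- by rewrite e /add_pair (negPf (off _ pj)) (negPf (off _ qj)) /= orbF.
by rewrite e.
Qed.

Lemma common_inl_cover (c : circle al) : c \notin affected al j ->
  exists u : common al be j, common_inl u = c.
Proof.
move=> caff; have := caff; rewrite /affected in_set negbK => c0.
have [x xU cE] := imsetP (valP c).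
have xc : x \in val c by rewrite cE inE connect0.
have cbe : val c \in circles be.
  apply/circleP; exists x => //; rewrite cE; apply/setP => y; rewrite !inE.
  apply: saddle_off => z zj; apply: contra caff => xz; apply/mem_affected.
  by exists z => //; rewrite cE inE.
have uP : [&& val c \in circles al, val c \in circles be & val c :&: ends j == set0].
  by rewrite (valP c) cbe c0.
by exists (exist (fun c => [&& c \in circles al, c \in circles be & c :&: ends j == set0])
  _ uP); apply: val_inj.
Qed.

Lemma common_inr_cover (c : circle be) : c \notin affected be j ->
  exists u : common al be j, common_inr u = c.
Proof.
move=> caff; have := caff; rewrite /affected in_set negbK => c0.
have [x xU cE] := imsetP (valP c).
have xc : x \in val c by rewrite cE inE connect0.
have cal : val c \in circles al.
  apply/circleP; exists x => //; rewrite cE; apply/setP => y; rewrite !inE.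
  apply: saddle_off' => z zj; apply: contra caff => xz; apply/mem_affected.
  by exists z => //; rewrite cE inE.
have uP : [&& val c \in circles al, val c \in circles be & val c :&: ends j == set0].
  by rewrite (valP c) cal c0.
by exists (exist (fun c => [&& c \in circles al, c \in circles be & c :&: ends j == set0])
  _ uP); apply: val_inj.
Qed.

Lemma card_circle_al : #|circle al| = (#|affected al j| + #|common al be j|)%N.
Proof.
rewrite -(cardsC (affected al j)) -[#|common _ _ _|]cardsT; congr (_ + _)%N.
rewrite -(card_imset _ (@common_inl_inj al be j)); apply: eq_card => c.
rewrite in_setC; apply/idP/imsetP => [/common_inl_cover[u <-]|[u _ ->]].
  by exists u.
exact: common_inl_unaffected.
Qed.

Lemma card_circle_be : #|circle be| = (#|affected be j| + #|common al be j|)%N.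
Proof.
rewrite -(cardsC (affected be j)) -[#|common _ _ _|]cardsT; congr (_ + _)%N.
rewrite -(card_imset _ (@common_inr_inj al be j)); apply: eq_card => c.
rewrite in_setC; apply/idP/imsetP => [/common_inr_cover[u <-]|[u _ ->]].
  by exists u.
exact: common_inr_unaffected.
Qed.

End Saddle.

Lemma affected1 al j p : p \in ends j ->
  (forall x, x \in ends j -> connect (adj al) p x) ->
  exists2 a : circle al, p \in val a & affected al j = [set a].
Proof.
move=> pj h; have [a aE] := circle_of al (ends_unmatched hGm pj).
have pa : p \in val a by rewrite aE inE connect0.
exists a => //; apply/setP => c; rewrite in_set1.
apply/mem_affected/eqP => [[x xc xj]|->]; last by exists p.
by apply: (@circle_eq _ _ _ x) => //; rewrite aE inE h.
Qed.

Lemma affected2 al j p q : p \in ends j -> q \in ends j ->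
  ~~ connect (adj al) p q ->
  (forall x, x \in ends j -> connect (adj al) p x || connect (adj al) q x) ->
  exists a b : circle al, [/\ p \in val a, q \in val b, a != b &
    affected al j = [set a; b]].
Proof.
move=> pj qj pq h; have [a aE] := circle_of al (ends_unmatched hGm pj).
have [b bE] := circle_of al (ends_unmatched hGm qj).
have pa : p \in val a by rewrite aE inE connect0.
have qb : q \in val b by rewrite bE inE connect0.
exists a, b; split=> //.
  by apply: contra pq => /eqP ab; move: qb; rewrite -ab aE inE.
apply/setP => c; rewrite in_set2; apply/mem_affected/orP => [[x xc xj]|].
  by have /orP[px|qx] := h x xj; [left|right]; apply/eqP;
    apply: (@circle_eq _ _ _ x) => //; rewrite ?aE ?bE inE.
by case=> /eqP ->; [exists p | exists q].
Qed.

(** The unaffected circles are common to both states, and the affected ones number 2 and 1, 1 and 2,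
    or 1 and 1. *)
Lemma saddle_card al be j t p q :
  saddle (ends j) (connect (adj al)) (connect (adj be)) t p q ->
  (#|circle be|)%:Z = (#|circle al|)%:Z + t.
Proof.
move=> sad; rewrite (card_circle_al sad) (card_circle_be sad) !PoszD.
have one al' p' : p' \in ends j -> (forall x, x \in ends j -> connect (adj al') p' x) ->
    #|affected al' j| = 1%N.
  by move=> pj h; have [a _ ->] := affected1 pj h; rewrite cards1.
have two al' p' q' : p' \in ends j -> q' \in ends j -> ~~ connect (adj al') p' q' ->
  (forall x, x \in ends j -> connect (adj al') p' x || connect (adj al') q' x) ->
    #|affected al' j| = 2%N.
  move=> pj qj pq h; have [a [b [_ _ ab ->]]] := affected2 pj qj pq h.
  by rewrite cards2 ab.
have [r s tr] := adj_equiv al; have [r' s' tr'] := adj_equiv be.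
case: sad => [p' q' pj qj pq h e|p' q' pj qj pq h e|p' pj h e].
- rewrite (two _ _ _ pj qj pq h) (one _ _ pj).
    by rewrite addrAC.
  move=> x xj; rewrite e; apply/add_pairP; case/orP: (h x xj); first by left.
  by right; left; rewrite connect0.
- rewrite (two _ _ _ pj qj pq h) (one _ _ pj).
    by rewrite addrAC.
  move=> x xj; rewrite e; apply/add_pairP; case/orP: (h x xj); first by left.
  by right; left; rewrite connect0.
rewrite (one _ _ pj h) (one _ _ pj) ?addr0 // => x xj.
by rewrite e h.
Qed.

End Circles.

(** * Edge maps on labelled states *)

HB.instance Definition _ (R : comPzRingType) (F : MTQFT R) :=
  Monoid.isComLaw.Build (mt_V F : Type) (vone F) (@vmul R F)
    (@vmulA R F) (@vmulC R F) (@vmul1l R F).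

Section Labels.
Variables (R : comPzRingType) (F : MTQFT R) (H : finType).
Local Notation V := (mt_V F).
Local Notation label := {ffun H -> V}.
Implicit Types (w : label) (u : H) (x y : V).

Definition mul_at w u x : label := [ffun h => if h == u then vmul (w h) x else w h].

Lemma mul_atC w u u' x x' : mul_at (mul_at w u x) u' x' = mul_at (mul_at w u' x') u x.
Proof.
apply/ffunP => h; rewrite !ffunE; do !case: (_ == _) => //.
by rewrite -!vmulA (vmulC x).
Qed.

Lemma mul_at_mul_at w u x x' : mul_at (mul_at w u x) u x' = mul_at w u (vmul x x').
Proof. by apply/ffunP => h; rewrite !ffunE; case: (_ == _); rewrite ?vmulA. Qed.

Definition circle_prod (c : {set H}) w : V := \big[@vmul R F/vone F]_(u in c) w u.

Lemma circle_prod_in (c : {set H}) w u x : u \in c ->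
  circle_prod c (mul_at w u x) = vmul (circle_prod c w) x.
Proof.
move=> uc; rewrite /circle_prod (bigD1 u) //= [in RHS](bigD1 u) //= ffunE eqxx.
rewrite -!vmulA (vmulC x); do 2!congr (vmul _ _).
by apply: eq_bigr => h /andP[_ /negPf hu]; rewrite ffunE hu.
Qed.

Lemma circle_prod_out (c : {set H}) w u x : u \notin c ->
  circle_prod c (mul_at w u x) = circle_prod c w.
Proof.
move=> uc; apply: eq_bigr => h hc; rewrite ffunE.
by case: eqP => // hu; rewrite hu (negPf uc) in hc.
Qed.

Lemma circle_prodU (A B : {set H}) w : [disjoint A & B] ->
  circle_prod (A :|: B) w = vmul (circle_prod A w) (circle_prod B w).
Proof.
move=> AB; rewrite /circle_prod [LHS](eq_bigl (fun u => u \in [predU A & B])).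
  by rewrite bigU.
by move=> u; rewrite !inE.
Qed.

Section Band.
Variable W : lmodType R.
Implicit Type Z : label -> W.

(* Multiplication by a local element: [1] for a merge, [theta] at [p] for a
   one-circle-to-one map, and [Delta 1] placed at [p] and [q] for a split. *)
Definition band (t : int) (p q : H) Z w : W :=
  if t == -1 then Z w else if t == 0 then Z (mul_at w p (vtheta F))
  else \sum_(e : bas V * bas V) Defs.coord (copair F) e *:
         Z (mul_at (mul_at w p (bvec e.1)) q (bvec e.2)).

(** Cocommutativity: [Delta 1] is invariant under the swap. *)
Lemma band_sym Z w p q : band 1 p q Z w = band 1 q p Z w.
Proof.
rewrite /band /= [in LHS]/= [LHS](reindex_inj (h := fun e => (e.2, e.1))) /=; last first.
  by move=> [a b] [c d] [-> ->].
apply: eq_bigr => e _; rewrite mul_atC; congr (_ *: _).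
rewrite -[in LHS]copair_sym /rm_brd.
rewrite (@coord_bas_push _ (rm_tob V V) (rm_tob V V) _ (fun p => (p.2, p.1)));
  do ?[by case].
by case: e.
Qed.

End Band.
End Labels.

(** * Edge maps evaluated on labelled states *)

Section EdgeMap.
Variables (R : comPzRingType) (F : MTQFT R).
Local Notation V := (mt_V F).
Variables (Gm : ribbon) (M : matching Gm) (hGm : trivalent Gm).
Local Notation H := (Defs.half Gm).
Implicit Types (al be : state M) (w : {ffun H -> V}).

(* Each circle carries the product of the labels of its half-edges. *)
Definition labelled al w : tpow V (circle al) :=
  ptpow (fun c : circle al => circle_prod (val c) w).

(** Only the product of labels along each circle matters. *)
Lemma labelled_class al p q w x : connect (adj al) p q ->
  labelled al (mul_at w p x) = labelled al (mul_at w q x).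
Proof.
move=> pq; have [r s t] := adj_equiv al.
apply: eq_ptpow => c; case: (boolP (p \in val c)) => [pc|npc].
  by rewrite !circle_prod_in // (mem_circle _ pc).
rewrite !circle_prod_out //; apply: contra npc => qc.
by rewrite (mem_circle _ qc) s.
Qed.

Lemma labelled_linear al p w : p \in unmatched M ->
  linear (fun x => labelled al (mul_at w p x)).
Proof.
move=> pU a x y; have [c cE] := circle_of al pU.
have pc : p \in val c by rewrite cE inE connect0.
apply: (ptpow_slot (i := c)).
- by rewrite !circle_prod_in // linearP.
- move=> k kc; rewrite !circle_prod_out //;
    by apply: contra kc => pk; apply/eqP; exact: circle_eq pk pc.
- move=> k kc; rewrite !circle_prod_out //;
    by apply: contra kc => pk; apply/eqP; exact: circle_eq pk pc.
Qed.

(** Labelled tensors span, since every basis vector is one of them. *)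
Lemma labelled_basisP al (W : lmodType R) (f g : {linear tpow V (circle al) -> W}) :
  (forall w, f (labelled al w) = g (labelled al w)) -> f =1 g.
Proof.
move=> fg; apply: lin_basisP => x; rewrite ptpow_bvec.
(* One half-edge is chosen on each circle to carry the basis element; all others get the label
   [1]. *)
pose rep (c : circle al) := xchoose (circle_neq0 c).
have repP c : rep c \in val c by exact: xchooseP.
pose w : {ffun H -> V} :=
  [ffun u => if [pick c | rep c == u] is Some c then bvec (x c) else vone F].
suff <- : labelled al w = ptpow (fun c => bvec (x c)) by exact: fg.
apply: eq_ptpow => c; rewrite /circle_prod (bigD1 (rep c)) //= big1 => [|u /andP[uc urep]].
  rewrite vmulC vmul1l ffunE; case: pickP => [d /eqP dc|/(_ c)]; last by rewrite eqxx.
  congr (bvec (x _)); apply: (circle_eq (x := rep c)) => //; by rewrite -dc.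
rewrite ffunE; case: pickP => // d /eqP du.
have dc : d = c by apply: (circle_eq (x := u)) => //; rewrite -du.
by rewrite -du dc eqxx in urep.
Qed.

(** [edge_map] lists the affected circles by [enum], whose order is not known. *)
Lemma enum_set2 (T : finType) (a b : T) : a != b ->
  enum [set a; b] = [:: a; b] \/ enum [set a; b] = [:: b; a].
Proof.
move=> ab; have: perm_eq (enum [set a; b]) [:: a; b].
  apply: uniq_perm; rewrite ?enum_uniq //= ?inE ?ab // => x.
  by rewrite mem_enum !inE.
move=> pe; have := perm_size pe; have := perm_mem pe; have := enum_uniq [set a; b].
case: (enum _) => [|x [|y [|? ?]]] //=; rewrite inE andbT => xy mem _.
have := mem y; have := mem x; rewrite !inE !eqxx orbT /=.
move=> /esym/orP[]/eqP ? /esym/orP[]/eqP ?; subst x y; auto.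
  by rewrite eqxx in xy.
by rewrite eqxx in xy.
Qed.

Section Step.
Variables (al be : state M) (j : 'I_(msize M)).
Local Notation inl := (@common_inl _ _ al be j).
Local Notation inr := (@common_inr _ _ al be j).
Variables (t : int) (p q : H).
Hypothesis sad : saddle (ends j) (connect (adj al)) (connect (adj be)) t p q.

Lemma circle_disjoint (ga : state M) (a b : circle ga) :
  a != b -> [disjoint val a & val b].
Proof.
move=> ab; rewrite disjoint_subset; apply/subsetP => u ua; rewrite inE.
by apply: contra ab => ub; apply/eqP; exact: circle_eq ua ub.
Qed.

Lemma common_out (ga : state M) (a c : circle ga) (h : H) :
  h \in val a -> c != a -> h \notin val c.
Proof. by move=> ha; apply: contra => hc; apply/eqP; exact: circle_eq hc ha. Qed.

Lemma inl_out a : a \in affected al j -> forall u, inl u != a.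
Proof.
move=> aa u; apply: contraTneq aa => <-; exact: common_inl_unaffected.
Qed.

Lemma inr_out a : a \in affected be j -> forall u, inr u != a.
Proof.
move=> aa u; apply: contraTneq aa => <-; exact: common_inr_unaffected.
Qed.

Lemma split1_labelled a w : affected al j = [set a] ->
  Defs.split1 F inl a (labelled al w) =
  ptens (circle_prod (val a) w) (ptpow (fun u => circle_prod (val (inl u)) w)).
Proof.
move=> aE; apply: (@split1_ptpow _ F _ _ inl _ a _ _ (fun c => circle_prod (val c) w)).
- exact: common_inl_inj.
- by apply: inl_out; rewrite aE set11.
- by move=> i ia; apply: (common_inl_cover sad); rewrite aE in_set1.
Qed.

Lemma split2_labelled a b w : a != b -> affected al j = [set a; b] ->
  Defs.split2 F inl a b (labelled al w) =
  ptens (ptens (circle_prod (val a) w) (circle_prod (val b) w))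
    (ptpow (fun u => circle_prod (val (inl u)) w)).
Proof.
move=> ab aE; apply: (@split2_ptpow _ F _ _ inl _ a b _ _ _ _ (fun c => circle_prod (val c) w)) => //.
- exact: common_inl_inj.
- by apply: inl_out; rewrite aE set21.
- by apply: inl_out; rewrite aE set22.
- by move=> i ia ib; apply: (common_inl_cover sad); rewrite aE in_set2 negb_or ia.
Qed.

Lemma join1_labelled c w x : affected be j = [set c] -> circle_prod (val c) w = x ->
  Defs.join1 F inr c (ptens x (ptpow (fun u => circle_prod (val (inr u)) w))) = labelled be w.
Proof.
move=> cE <-; apply: (@join1_ptens _ F _ _ inr _ c _ _ (fun c => circle_prod (val c) w)).
- exact: common_inr_inj.
- by apply: inr_out; rewrite cE set11.
- by move=> i ic; apply: (common_inr_cover sad); rewrite cE in_set1.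
Qed.

Lemma join2_labelled b c w x y : b != c -> affected be j = [set b; c] ->
  circle_prod (val b) w = x -> circle_prod (val c) w = y ->
  Defs.join2 F inr b c (ptens (ptens x y) (ptpow (fun u => circle_prod (val (inr u)) w))) =
  labelled be w.
Proof.
move=> bc cE <- <-; apply: (@join2_ptens _ F _ _ inr _ b c _ _ _ _ (fun c => circle_prod (val c) w)) => //.
- exact: common_inr_inj.
- by apply: inr_out; rewrite cE set21.
- by apply: inr_out; rewrite cE set22.
- by move=> i ib ic; apply: (common_inr_cover sad); rewrite cE in_set2 negb_or ib.
Qed.

Lemma merge_labelled (a b : circle al) (c : circle be) w :
  a != b -> affected al j = [set a; b] -> affected be j = [set c] ->
  val c = val a :|: val b ->
  Defs.join1 F inr c (rm_tho (mt_mu F) idfun (Defs.split2 F inl a b (labelled al w))) =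
  labelled be w.
Proof.
move=> ab affa affc cE; rewrite split2_labelled // rm_thoE; apply: join1_labelled => //.
by rewrite cE circle_prodU // circle_disjoint.
Qed.

Lemma twist_labelled (a : circle al) (c : circle be) w h :
  affected al j = [set a] -> affected be j = [set c] -> val c = val a ->
  h \in val a ->
  Defs.join1 F inr c (rm_tho (mt_m F) idfun (Defs.split1 F inl a (labelled al w))) =
  labelled be (mul_at w h (vtheta F)).
Proof.
move=> affa affc cE ha; rewrite split1_labelled // rm_thoE.
rewrite -(join1_labelled (w := mul_at w h (vtheta F)) affc (erefl _)).
rewrite cE (circle_prod_in _ _ ha) mt_mE vmulC.
congr (Defs.join1 F inr c (ptens _ _)); apply: eq_ptpow => u.
rewrite circle_prod_out // (@common_out _ c) ?cE //.
by apply: inr_out; rewrite affc set11.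
Qed.

(** The label of [a] is the product of those of [b] and [c], so [mt_Delta_mul] puts each on its own
    side of [Delta 1], whose two legs are then absorbed at [h] and [k]. *)
Lemma split_labelled (a : circle al) (b c : circle be) w h k :
  b != c -> affected al j = [set a] -> affected be j = [set b; c] ->
  val a = val b :|: val c -> h \in val b -> k \in val c ->
  Defs.join2 F inr b c (rm_tho (mt_Delta F) idfun (Defs.split1 F inl a (labelled al w))) =
  band 1 h k (labelled be) w.
Proof.
move=> bc affa affc aE hb kc; rewrite split1_labelled // rm_thoE aE circle_prodU ?circle_disjoint //.
rewrite mt_Delta_mul (tens_sum (copair F)).
rewrite (linear_comb _ _ (linearP _)) (linear_comb _ _ (ptens_linearl _)).
rewrite (linear_comb _ _ (linearP _)); apply: eq_bigr => e _; congr (_ *: _).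
rewrite rm_thoE; have hc : h \notin val c by apply: common_out hb _; rewrite eq_sym.
have kb : k \notin val b by apply: common_out kc _.
rewrite -(join2_labelled (w := mul_at _ _ _) bc affc (erefl _) (erefl _)).
rewrite (circle_prod_out _ _ kb) (circle_prod_in _ _ hb) (circle_prod_in _ _ kc).
rewrite (circle_prod_out _ _ hc).
congr (Defs.join2 F inr b c (ptens _ _)); apply: eq_ptpow => u.
rewrite !circle_prod_out //; [apply: common_out hb _ | apply: common_out kc _];
  by apply: inr_out; rewrite affc ?set21 ?set22.
Qed.

End Step.

Lemma edge_map_labelled (G : zmodType) (m : nat) (gens : 'I_m -> G)
    (P : G -> V -> Prop) (s : 'I_m -> int) al be j t p q w :
  saddle (ends j) (connect (adj al)) (connect (adj be)) t p q ->
  edge_map gens P s al be j (labelled al w) = band t p q (labelled be) w.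
Proof.
move=> sad; have [r sy tr] := adj_equiv al; have [r' sy' tr'] := adj_equiv be.
case: (sad) => [p' q' pj qj pq h e|p' q' pj qj pq h e|p' pj h e].
- have [a [b [pa qb ab affa]]] := affected2 hGm pj qj pq h.
  have [c pc affc] : exists2 c : circle be, p' \in val c & affected be j = [set c].
    apply: (affected1 hGm pj) => x xj; rewrite e; apply/add_pairP.
    by case/orP: (h x xj) => [|qx]; [left | right; left; rewrite connect0].
  have cE : val c = val a :|: val b.
    apply/setP => x; rewrite in_setU (mem_circle _ pa) (mem_circle _ qb) (mem_circle _ pc) e.
    by rewrite /add_pair connect0 (negPf pq) /= orbF.
  rewrite /edge_map affa affc enum_set1.
  have [->|->] := enum_set2 ab; first exact: (merge_labelled sad).
  by apply: (merge_labelled sad); rewrite 1?eq_sym // setUC.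
- have [b [c [pb qc bc affc]]] := affected2 hGm pj qj pq h.
  have [a pa affa] : exists2 a : circle al, p' \in val a & affected al j = [set a].
    apply: (affected1 hGm pj) => x xj; rewrite e; apply/add_pairP.
    by case/orP: (h x xj) => [|qx]; [left | right; left; rewrite connect0].
  have aE : val a = val b :|: val c.
    apply/setP => x; rewrite in_setU (mem_circle _ pb) (mem_circle _ qc) (mem_circle _ pa) e.
    by rewrite /add_pair connect0 (negPf pq) /= orbF.
  rewrite /edge_map affa affc enum_set1.
  have [->|->] := enum_set2 bc; first exact: (split_labelled sad).
  by rewrite band_sym; apply: (split_labelled sad); rewrite 1?eq_sym // setUC.
have [a pa affa] := affected1 hGm pj h.
have [c pc affc] : exists2 c : circle be, p' \in val c & affected be j = [set c].
  by apply: (affected1 hGm pj) => x xj; rewrite e; apply: h.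
have cE : val c = val a.
  by apply/setP => x; rewrite (mem_circle _ pa) (mem_circle _ pc) e.
by rewrite /edge_map affa affc !enum_set1; apply: (twist_labelled sad).
Qed.

End EdgeMap.

(** * Commutation of squares *)

Section BandTheory.
Variables (R : comPzRingType) (F : MTQFT R) (H : finType) (W : lmodType R).
Local Notation V := (mt_V F).
Local Notation label := {ffun H -> V}.
Implicit Types (w : label) (Z : label -> W).

Lemma eq_band t p q Z Z' : Z =1 Z' -> band t p q Z =1 band t p q Z'.
Proof.
move=> ZZ w; rewrite /band !ZZ; case: (t == -1) => //; case: (t == 0) => //.
by apply: eq_bigr => e _; rewrite ZZ.
Qed.

(** Bands multiply labels, and multiplication is commutative. *)
Lemma band_band t p q t' p' q' Z w :
  band t p q (band t' p' q' Z) w = band t' p' q' (band t p q Z) w.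
Proof.
rewrite /band; case: (t == -1); case: (t' == -1) => //; case: (t == 0); case: (t' == 0) => //.
- by rewrite mul_atC.
- by apply: eq_bigr => e _; rewrite (mul_atC w) (mul_atC (mul_at w _ _)).
- by apply: eq_bigr => e _; rewrite (mul_atC (mul_at w _ _)) (mul_atC w).
under eq_bigr do rewrite scaler_sumr; rewrite exchange_big /=.
apply: eq_bigr => e _; rewrite scaler_sumr; apply: eq_bigr => e' _.
rewrite !scalerA mulrC; congr (_ *: Z _).
by rewrite (mul_atC (mul_at w p _) q p') (mul_atC (mul_at _ p' _) q q') (mul_atC w p p')
  (mul_atC (mul_at w p' _) p q').
Qed.

Variables (e : rel H) (U : {set H}).

Definition class_invariant Z := forall p q w x, e p q -> Z (mul_at w p x) = Z (mul_at w q x).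
Definition slot_linear Z := forall p w, p \in U -> linear (fun x => Z (mul_at w p x)).

Lemma band_class_invariant t p q Z : class_invariant Z -> class_invariant (band t p q Z).
Proof.
move=> Zi p' q' w x pq; rewrite /band.
case: (t == -1); first exact: Zi; case: (t == 0).
  by rewrite (mul_atC w p') (mul_atC w q'); apply: Zi.
apply: eq_bigr => d _; congr (_ *: _).
rewrite (mul_atC w p') (mul_atC w q') (mul_atC _ p') (mul_atC _ q'); exact: Zi.
Qed.

Lemma band_class t p q p' q' Z w : class_invariant Z -> e p p' -> e q q' ->
  band t p q Z w = band t p' q' Z w.
Proof.
move=> Zi pp qq; rewrite /band.
case: (t == -1) => //; case: (t == 0); first exact: Zi.
apply: eq_bigr => d _; congr (_ *: _).
by rewrite (Zi q q') // mul_atC (Zi p p') // mul_atC.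
Qed.

Definition same_pair p q p' q' := e p p' /\ e q q' \/ e p q' /\ e q p'.

Lemma band_pair p q p' q' Z w : class_invariant Z -> same_pair p q p' q' ->
  band 1 p q Z w = band 1 p' q' Z w.
Proof.
move=> Zi [[pp qq]|[pq qp]]; first exact: band_class.
by rewrite band_sym; apply: band_class.
Qed.

Hypothesis hF : mt_F F (mc_cmp mc_m mc_m) =1 mt_F F (mc_cmp mc_mu mc_Delta).

(** On a single circle both legs of [Delta 1] meet at [p], giving [mu (Delta 1)], which is
    [theta ^ 2] by the hypothesis on the MTQFT. *)
Lemma band_loop p q Z w : class_invariant Z -> slot_linear Z -> p \in U -> e p q ->
  band 1 p q Z w = band 0 p p (band 0 p p Z) w.
Proof.
move=> Zi Zl pU pq; rewrite /band /= mul_at_mul_at -(mt_mu_copair hF).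
rewrite {2}(tens_sum (copair F)) (linear_comb _ _ (linearP _)) (linear_comb _ _ (Zl p w pU)).
apply: eq_bigr => d _; congr (_ *: _); rewrite -(Zi p q) //.
by rewrite mul_at_mul_at.
Qed.

Lemma tens_slots p q Z w x y : slot_linear Z -> p \in U -> q \in U ->
  \sum_(d : bas V * bas V) Defs.coord (ptens x y) d *:
     Z (mul_at (mul_at w p (bvec d.1)) q (bvec d.2)) = Z (mul_at (mul_at w p x) q y).
Proof.
move=> Zl pU qU; rewrite [in RHS](coord_sum y) (linear_comb _ _ (Zl q _ qU)).
transitivity (\sum_b \sum_a Defs.coord y b *: (Defs.coord x a *:
    Z (mul_at (mul_at w p (bvec a)) q (bvec b)))).
  rewrite exchange_big pair_big /=; apply: eq_bigr => -[a b] _.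
  by rewrite coord_ptens /= scalerA mulrC.
apply: eq_bigr => b _; rewrite -scaler_sumr; congr (_ *: _).
rewrite [in RHS](coord_sum x) mul_atC (linear_comb _ _ (Zl p _ pU)).
by apply: eq_bigr => a _; rewrite mul_atC.
Qed.

(** Placing a tensor at the two slots is linear in the tensor, so it suffices to compare pure
    tensors. *)
Lemma tho_slots p q Z w (f g : {linear V -> V}) t :
  slot_linear Z -> p \in U -> q \in U ->
  \sum_(d : bas V * bas V) Defs.coord (rm_tho f g t) d *:
     Z (mul_at (mul_at w p (bvec d.1)) q (bvec d.2)) =
  \sum_(d : bas V * bas V) Defs.coord t d *:
     Z (mul_at (mul_at w p (f (bvec d.1))) q (g (bvec d.2))).
Proof.
move=> Zl pU qU.
pose B (t : rm_tob V V) := \sum_(d : bas V * bas V) Defs.coord t d *: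
     Z (mul_at (mul_at w p (bvec d.1)) q (bvec d.2)).
have Bl : linear B.
  move=> a x y; rewrite /B scaler_sumr -big_split; apply: eq_bigr => d _ /=.
  by rewrite !ffunE scalerDl scalerA.
rewrite -/(B _) {1}(tens_sum t) (linear_comb _ _ (linearP (rm_tho f g))).
rewrite (linear_comb _ _ Bl); apply: eq_bigr => d _; congr (_ *: _).
by rewrite rm_thoE /B tens_slots.
Qed.

(** The Frobenius relation: a label passes from one leg of [Delta 1] to the other. *)
Lemma band_slide p q Z w x : slot_linear Z -> p \in U -> q \in U ->
  band 1 p q Z (mul_at w p x) = band 1 p q Z (mul_at w q x).
Proof.
move=> Zl pU qU; rewrite /band /=.
transitivity (\sum_(d : bas V * bas V) Defs.coord (copair F) d *:
    Z (mul_at (mul_at w p (vmul x (bvec d.1))) q (idfun (bvec d.2)))).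
  by apply: eq_bigr => d _; rewrite mul_at_mul_at.
rewrite -(tho_slots w (vmul x) idfun) // copair_slide tho_slots //.
by apply: eq_bigr => d _; rewrite (mul_atC w q) mul_at_mul_at.
Qed.

End BandTheory.

Section PairLemmas.
Variables (T : finType) (e : rel T).
Hypothesis eE : is_equiv e.

(** If joining [a] and [b] is what identifies [x] with [y], then these lie in the two classes being
    joined. *)
Lemma add_pair_same_pair a b x y : ~~ e x y -> add_pair e a b x y -> same_pair e x y a b.
Proof.
case: eE => r s t nxy /add_pairP[xy|[[xa by_]|[xb ay]]]; first by rewrite xy in nxy.
  by left; split; rewrite // s.
by right; split; rewrite // s.
Qed.

Lemma cover_same_pair (E : {set T}) a b x y :
  (forall z, z \in E -> e a z || e b z) -> x \in E -> y \in E -> ~~ e x y ->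
  same_pair e x y a b.
Proof.
case: eE => r s t cov /cov xE /cov yE nxy.
case/orP: xE => hx; case/orP: yE => hy.
- by move: nxy; rewrite (t a) // s.
- by left; split; rewrite s.
- by right; split; rewrite s.
- by move: nxy; rewrite (t b) // s.
Qed.

Lemma same_pair_add_pair a b x y : same_pair e x y a b -> add_pair e a b x y.
Proof.
case: eE => r s t h; apply/add_pairP; right.
by case: h => -[h1 h2]; [left | right]; split; rewrite // s.
Qed.

Lemma cover_add_pair (E : {set T}) a b x y :
  (forall z, z \in E -> e a z || e b z) -> x \in E -> y \in E ->
  add_pair e a b x y.
Proof.
move=> cov xE yE; case: (boolP (e x y)) => [|nxy]; first exact: add_pair_sub.
exact: same_pair_add_pair (cover_same_pair cov xE yE nxy).
Qed.

End PairLemmas.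

(** * The two ways around a square of saddles *)

Section Square.
Variables (R : comPzRingType) (F : MTQFT R) (H : finType) (W : lmodType R).
Hypothesis hF : mt_F F (mc_cmp mc_m mc_m) =1 mt_F F (mc_cmp mc_mu mc_Delta).
Local Notation V := (mt_V F).
Variables (Z : {ffun H -> V} -> W) (U Ej Ek : {set H}) (ea eb eb' ec : rel H).
Hypotheses (EjU : Ej \subset U) (EkU : Ek \subset U).
Hypotheses (eaE : is_equiv ea) (ebE : is_equiv eb) (ebE' : is_equiv eb')
  (ecE : is_equiv ec).
Hypotheses (Zi : class_invariant ec Z) (Zl : slot_linear U Z).

Lemma band_slide_class u p q w : p \in U -> q \in U -> ec p u || ec q u ->
  band 0 u u (band 1 p q Z) w = band 0 p p (band 1 p q Z) w.
Proof.
have [cr cs ct] := ecE.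
have Zi' := band_class_invariant 1 p q Zi.
move=> pU qU /orP[pu|qu]; first by rewrite (band_class _ _ Zi' pu pu).
rewrite -(band_class _ _ Zi' qu qu).
exact: esym (band_slide w (vtheta F) Zl pU qU).
Qed.

Lemma band_class2 t p p' t' q q' w : ec p p' -> ec q q' ->
  band t p p (band t' q q Z) w = band t p' p' (band t' q' q' Z) w.
Proof.
move=> pp qq; rewrite (band_class _ _ (band_class_invariant _ _ _ Zi) pp pp).
by apply: eq_band => {}w; exact: (band_class _ _ Zi qq qq).
Qed.

(** Of the 81 combinations of saddles the count of circles and [t1 <= t2'] leave 14. Four merges are
    trivial, since both sides are [Z w]; below, each case lists the first way, then the second. *)
Lemma band_square_le t1 p1 q1 t2 p2 q2 t1' p1' q1' t2' p2' q2' w :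
  saddle Ej ea eb t1 p1 q1 -> saddle Ek eb ec t2 p2 q2 ->
  saddle Ek ea eb' t2' p2' q2' -> saddle Ej eb' ec t1' p1' q1' ->
  t1 + t2 = t2' + t1' -> t1 <= t2' ->
  band t1 p1 q1 (band t2 p2 q2 Z) w = band t2' p2' q2' (band t1' p1' q1' Z) w.
Proof.
have [ar as_ at_] := eaE; have [br bs bt] := ebE; have [br' bs' bt'] := ebE'.
have [cr cs ct] := ecE.
case=> {t1 p1 q1} [p1 q1 p1j q1j n1 h1 e1|p1 q1 p1j q1j n1 h1 e1|p1 p1j h1 e1];
case=> {t2 p2 q2} [p2 q2 p2k q2k n2 h2 e2|p2 q2 p2k q2k n2 h2 e2|p2 p2k h2 e2];
case=> {t2' p2' q2'} [p2' q2' p2k' q2k' n2' h2' e2'|p2' q2' p2k' q2k' n2' h2' e2'|p2' p2k' h2' e2'];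
case=> {t1' p1' q1'} [p1' q1' p1j' q1j' n1' h1' e1'|p1' q1' p1j' q1j' n1' h1' e1'|p1' p1j' h1' e1'];
  move=> te tl; first [discriminate te | discriminate tl | clear te tl => //].
(* Merge, split and merge, split: the first merge puts all of [Ej] on one circle, so the split at
   [Ek] is what separates [p1'] from [q1']. *)
- apply/esym/(band_pair _ Zi); apply: (add_pair_same_pair ecE n1').
  by rewrite -e2 e1; exact: (cover_add_pair eaE h1).
(* Merge, split and split, merge: both splits are at [Ek], which meets the same two final
   circles. *)
- apply: (band_pair _ Zi); apply: (cover_same_pair ecE _ p2k q2k n2) => z zk.
  by rewrite !e1'; case/orP: (h2' z zk) => h; rewrite (add_pair_sub _ _ h) ?orbT.
(* Merge, split and twist, twist: impossible, [Ej] would start on one circle. *)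
- have := h1' _ p1j; have := h1' _ q1j; rewrite !e2' => hq hp.
  by case/negP: n1; rewrite (at_ p1') // as_.
(* Merge, twist and merge, twist: both merges join the same two circles, so [Ej] and [Ek] end on one
   circle, and so do the two [theta]. *)
- have hp := h1' _ p1j; have hq := h1' _ q1j.
  have : add_pair ea p2' q2' p1 q1 by rewrite -e2' (bt' p1') // bs'.
  move=> /(add_pair_same_pair eaE n1) sp.
  have [z zk pz] : exists2 z, z \in Ek & ea p1 z by case: sp => -[]; eauto.
  have pp : ec p2 p1'.
    apply: (ct z); first by rewrite e2; apply: h2.
    apply: (ct p1); first by rewrite e2 e1; apply: add_pair_sub; rewrite as_.
    by rewrite e1' bs'.
  exact: (band_class _ _ Zi pp pp).
(* Merge, twist and twist, merge: both [theta] are at [Ek], on one final circle. *)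
- have pp : ec p2 p2' by rewrite e2; apply: h2.
  exact: (band_class _ _ Zi pp pp).
(* Split, merge and split, merge: each pair of legs ends on one and the same circle, so both sides
   are [theta ^ 2] there. *)
- have pq : ec p1 q1 by rewrite e1'; apply: (cover_add_pair ebE' h1').
  have pq' : ec p2' q2' by rewrite e2; apply: (cover_add_pair ebE h2).
  have sp : same_pair eb p1 q1 p2 q2 by apply: (add_pair_same_pair ebE n1); rewrite -e2.
  have [z zk pz] : exists2 z, z \in Ek & eb p1 z by case: sp => -[]; eauto.
  have pp : ec p1 p2'.
    apply: (ct z); first by rewrite e2; apply: add_pair_sub.
    by rewrite e2; apply: (cover_add_pair ebE h2).
  rewrite !(band_loop hF _ Zi Zl) ?(subsetP EjU _ p1j) ?(subsetP EkU _ p2k') //.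
  exact: band_class2.
(* Four splits: later splits keep separated points apart, so the two copies of [Delta 1] agree edge
   by edge. *)
- have n1c : ~~ ec p1 q1 by apply: contra n1 => h; rewrite e2; apply: add_pair_sub.
  have n2c : ~~ ec p2' q2' by apply: contra n2' => h; rewrite e1'; apply: add_pair_sub.
  have sp1 := cover_same_pair ecE h1' p1j q1j n1c.
  have sp2 := cover_same_pair ecE h2 p2k' q2k' n2c.
  rewrite (band_pair _ (band_class_invariant _ _ _ Zi) sp1) [RHS]band_band.
  by apply: eq_band => {}w; apply/esym; exact: (band_pair _ Zi sp2).
(* Split, twist and split, twist: impossible, [Ek] would be both on one final circle and on two. *)
- case/negP: n2'; rewrite -e1' e2; apply: (bt p2); last exact: h2.
  by rewrite bs; apply: h2.
(* Twist, merge and twist, merge: impossible, [Ek] would start both on one circle and on two. *)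
- case/negP: n2; rewrite e1; apply: (at_ p2'); last exact: h2'.
  by rewrite as_; apply: h2'.
(* Twist, split and split, twist: the contributions agree edge by edge. *)
- have n2c : ~~ ec p2' q2' by rewrite e1'.
  have sp := cover_same_pair ecE h2 p2k' q2k' n2c.
  have pp : ec p1 p1' by rewrite e1' bs'; apply: h1'.
  rewrite [RHS]band_band (band_class _ _ (band_class_invariant _ _ _ Zi) pp pp).
  by apply: eq_band => {}w; apply/esym; exact: (band_pair _ Zi sp).
(* Twist, split and twist, split: both splits cut one circle into the same two, and the [theta]
   factors are compared by sliding across [Delta 1]. *)
- have sp : same_pair ec p2 q2 p1' q1'.
    apply: (add_pair_same_pair ecE n2); rewrite -e1' e2' -e1 e2; exact: add_pair_pair.
  rewrite [RHS](@eq_band _ _ _ _ _ _ _ _ (band 1 p2 q2 Z)); last first.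
    by move=> w'; apply/esym; exact: (band_pair _ Zi sp).
  have p2U := subsetP EkU _ p2k; have q2U := subsetP EkU _ q2k.
  rewrite [RHS](band_slide_class _ p2U q2U) ?h2 // (band_slide_class _ p2U q2U) //.
  case: sp => -[sp sq]; case/orP: (h1' _ p1j) => hp.
  + by rewrite (ct p1').
  + by rewrite orbC (ct q1').
  + by rewrite orbC (ct p1').
  + by rewrite (ct q1').
(* Twist, twist and split, merge: the legs of [Delta 1] are rejoined, giving [theta ^ 2] on the
   circle that carries both twists. *)
- have pq : ec p2' q2'.
    by rewrite e2; apply: (bt p2); [rewrite bs; apply: h2 | apply: h2].
  have sp : same_pair eb' p2' q2' p1' q1'.
    by apply: (add_pair_same_pair ebE' n2'); rewrite -e1'.
  have [z zj pz] : exists2 z, z \in Ej & eb' p2' z by case: sp => -[]; eauto.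
  have pp : ec p1 p2'.
    apply: (ct z); first by rewrite e2 e1; apply: h1.
    by rewrite cs e1'; apply: add_pair_sub.
  have pp2 : ec p2 p2' by rewrite e2; apply: h2.
  rewrite [RHS](band_loop hF _ Zi Zl) ?(subsetP EkU) //; exact: band_class2.
(* Four twists: the [theta] factors agree edge by edge. *)
have pp1 : ec p1 p1' by rewrite e1' bs'; apply: h1'.
have pp2 : ec p2 p2' by rewrite e2; apply: h2.
rewrite [RHS]band_band; exact: band_class2.
Qed.

End Square.

(** Exchanging the two ways around the square allows assuming [t1 <= t2']. *)
Theorem band_square (R : comPzRingType) (F : MTQFT R) (H : finType)
    (W : lmodType R)
    (hF : mt_F F (mc_cmp mc_m mc_m) =1 mt_F F (mc_cmp mc_mu mc_Delta))
    (Z : {ffun H -> mt_V F} -> W) (U Ej Ek : {set H}) (ea eb eb' ec : rel H)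
    t1 p1 q1 t2 p2 q2 t1' p1' q1' t2' p2' q2' w :
  Ej \subset U -> Ek \subset U ->
  is_equiv ea -> is_equiv eb -> is_equiv eb' -> is_equiv ec ->
  class_invariant ec Z -> slot_linear U Z ->
  saddle Ej ea eb t1 p1 q1 -> saddle Ek eb ec t2 p2 q2 ->
  saddle Ek ea eb' t2' p2' q2' -> saddle Ej eb' ec t1' p1' q1' ->
  t1 + t2 = t2' + t1' ->
  band t1 p1 q1 (band t2 p2 q2 Z) w = band t2' p2' q2' (band t1' p1' q1' Z) w.
Proof.
move=> EjU EkU eaE ebE ebE' ecE Zi Zl s1 s2 s2' s1' te.
case: (leP t1 t2') => tt.
  exact: (band_square_le hF EjU EkU eaE ebE ebE' ecE Zi Zl w s1 s2 s2' s1' te tt).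
apply/esym.
exact: (band_square_le hF EkU EjU eaE ebE' ebE ecE Zi Zl w s2' s1' s1 s2 (esym te) (ltW tt)).
Qed.

(** * The square of the differential *)

(** Terms with [j < k] cancel those with [k < j]; the diagonal must vanish by assumption, as 2 may
    be a zero divisor. *)
Lemma sum_antisym (V : zmodType) (n : nat) (T : 'I_n -> 'I_n -> V) :
  (forall j, T j j = 0) -> (forall j k, j != k -> T j k = - T k j) ->
  \sum_j \sum_k T j k = 0.
Proof.
move=> T0 Tn; rewrite pair_big /=.
rewrite (bigID (fun p : 'I_n * 'I_n => p.1 < p.2)%N) /=.
rewrite [X in _ + X](bigID (fun p : 'I_n * 'I_n => p.2 < p.1)%N) /=.
rewrite [X in _ + (_ + X)]big1 ?addr0; last first.
  move=> [j k] /=; rewrite -!leqNgt => /andP[kj jk].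
  have -> : j = k by apply/val_inj/anti_leq; rewrite jk.
  exact: T0.
rewrite [X in _ + X](reindex_inj (h := fun p : 'I_n * 'I_n => (p.2, p.1))) /=; last first.
  by move=> [a b] [c d] [-> ->].
rewrite [X in _ + X](eq_big (fun p : 'I_n * 'I_n => p.1 < p.2)%N
  (fun p : 'I_n * 'I_n => - T p.1 p.2)).
- by rewrite sumrN subrr.
- by move=> [j k] /=; rewrite -leqNgt; case: ltngtP.
by move=> [j k] /= /andP[_ jk]; rewrite Tn // neq_ltn jk orbT.
Qed.

Lemma swap_sign (R : pzRingType) (W : lmodType R) (n a b : nat) (j k : 'I_n) (y : W) :
  j != k -> (-1) ^+ ((j < k) + a + b) *: y = - ((-1) ^+ ((k < j) + b + a) *: y).
Proof.
move=> jk; rewrite -scaleNr -!addnA (addnC b) !(exprD _ (_ < _)%N); congr (_ *: _).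
by move: jk; case: ltngtP => [||/val_inj ->] //; rewrite ?mul1r ?mulN1r ?opprK // eqxx.
Qed.

(** * Signs in the cube of states *)

Section Signs.
Variables (Gm : ribbon) (M : matching Gm).
Implicit Types (al be ga : state M) (j k : 'I_(msize M)).

Definition flip_on al j : state M := [ffun k => (k == j) || al k].

Lemma stepE al be j : step al be j = ~~ al j && (be == flip_on al j).
Proof. by []. Qed.

Lemma weight_flip_on al j : ~~ al j -> weight (flip_on al j) = (weight al).+1.
Proof.
move=> alj; rewrite /weight (cardsD1 j) inE ffunE eqxx; congr _.+1.
apply: eq_card => k; rewrite !inE ffunE.
by case: eqP => // ->; rewrite (negPf alj).
Qed.

(** The new entry 1 at [j] is counted when it lies to the left of [k]. Of the two orders of changing
    [j] and [k], exactly one gains this sign. *)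
Lemma sgn_exp_flip_on al j k : ~~ al j ->
  sgn_exp (flip_on al j) k = ((j < k) + sgn_exp al k)%N.
Proof.
move=> alj; rewrite /sgn_exp (cardsD1 j) inE ffunE eqxx andbT; congr (_ + _)%N.
apply: eq_card => l; rewrite !inE ffunE.
by case: eqP => [->|_] //=; rewrite (negPf alj) andbF.
Qed.

Lemma flip_onC al j k : flip_on (flip_on al j) k = flip_on (flip_on al k) j.
Proof. by apply/ffunP => l; rewrite !ffunE orbCA. Qed.

(** A step is determined by its source and the changed entry, so at most one term of the sum
    survives. *)
Lemma sum_level_step (W : zmodType) (i : int) (al : level M i) j (f : state M -> W) :
  \sum_(be : level M (i + 1)) (if step (val al) (val be) j then f (val be) else 0) =
  if ~~ val al j then f (flip_on (val al) j) else 0.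
Proof.
case: ifP => [alj|alj]; last by rewrite big1 // => be _; rewrite stepE alj.
have bP : (weight (flip_on (val al) j))%:Z == i + 1.
  by rewrite weight_flip_on // -addn1 PoszD (eqP (valP al)).
pose b : level M (i + 1) :=
  exist (fun al : state M => (weight al)%:Z == i + 1) _ bP.
rewrite (bigD1 b) //= big1 ?addr0 => [|be bb]; first by rewrite stepE alj eqxx.
rewrite stepE alj /=; case: eqP => // e; case/eqP: bb; exact: val_inj.
Qed.

Lemma sum_squares (R : pzRingType) (T : state M -> lmodType R)
    (E : forall al be, 'I_(msize M) -> T al -> T be)
    (Ecomm : forall al be be' ga j k x,
      step al be j -> step be ga k -> step al be' k -> step be' ga j ->
      E be ga k (E al be j x) = E be' ga j (E al be' k x))
    al ga (x : T al) :
  let X be j k : T ga := (-1) ^+ sgn_exp be k *: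
    ((-1) ^+ sgn_exp al j *: E be ga k (E al be j x)) in
  \sum_j \sum_k (if ~~ al j then
    if step (flip_on al j) ga k then X (flip_on al j) j k else 0 else 0) = 0.
Proof.
move=> X; apply: sum_antisym => [j|j k jk].
  by rewrite stepE ffunE eqxx; case: ifP.
rewrite !stepE !ffunE (negPf jk) eq_sym (negPf jk) /= flip_onC.
case: (boolP (al j)) => /= alj; first by rewrite if_same oppr0.
case: (boolP (al k)) => /= alk; first by rewrite oppr0.
case: eqP => /= gaE; last by rewrite oppr0.
rewrite /X !sgn_exp_flip_on // !scalerA -!exprD.
have s1 : step al (flip_on al j) j by rewrite stepE alj eqxx.
have s1' : step al (flip_on al k) k by rewrite stepE alk eqxx.
have s2 : step (flip_on al j) ga k.
  by rewrite stepE ffunE eq_sym (negPf jk) alk gaE flip_onC eqxx.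
have s2' : step (flip_on al k) ga j.
  by rewrite stepE ffunE (negPf jk) alj gaE eqxx.
by rewrite (Ecomm _ _ _ _ _ _ x s1 s2 s1' s2') swap_sign.
Qed.

End Signs.

Section Complex.
Variables (R : comPzRingType) (F : MTQFT R).
Hypothesis hF : mt_F F (mc_cmp mc_m mc_m) =1 mt_F F (mc_cmp mc_mu mc_Delta).
Local Notation V := (mt_V F).
Variables (G : zmodType) (m : nat) (gens : 'I_m -> G).
Variables (P : G -> V -> Prop) (s : 'I_m -> int).
Variables (Gm : ribbon) (M : matching Gm) (hGm : trivalent Gm).
Local Notation edge al be j := (edge_map gens P s al be j).
Implicit Types (al be ga : state M) (j k : 'I_(msize M)).

Lemma band_linear (H : finType) (W W' : lmodType R) (f : {linear W -> W'}) t (p q : H)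
    (Z : {ffun H -> V} -> W) w :
  f (band t p q Z w) = band t p q (f \o Z) w.
Proof.
rewrite /band; case: (t == -1) => //; case: (t == 0) => //.
by rewrite linear_sum; apply: eq_bigr => e _; rewrite linearZ.
Qed.

(** The grading shift leaves the underlying module unchanged, so the edge map can be viewed between
    plain tensor powers. *)
Definition tedge al be j : {linear tpow V (circle al) -> tpow V (circle be)} :=
  edge al be j.

Lemma tedge_labelled al be j t p q w :
  saddle (ends j) (connect (adj al)) (connect (adj be)) t p q ->
  tedge al be j (labelled al w) = band t p q (labelled be) w.
Proof. exact: edge_map_labelled. Qed.

Lemma tedge_comm al be be' ga j k v :
  step al be j -> step be ga k -> step al be' k -> step be' ga j ->
  tedge be ga k (tedge al be j v) = tedge be' ga j (tedge al be' k v).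
Proof.
move=> s1 s2 s2' s1'.
pose f1 : {linear tpow V (circle al) -> tpow V (circle ga)} :=
  tedge be ga k \o tedge al be j.
pose f2 : {linear tpow V (circle al) -> tpow V (circle ga)} :=
  tedge be' ga j \o tedge al be' k.
apply: (labelled_basisP (f := f1) (g := f2)) => w.
rewrite -[LHS]/(tedge be ga k (tedge al be j (labelled al w))).
rewrite -[RHS]/(tedge be' ga j (tedge al be' k (labelled al w))).
have [t1 [p1 [q1 S1]]] := step_saddle hGm s1.
have [t2 [p2 [q2 S2]]] := step_saddle hGm s2.
have [t2' [p2' [q2' S2']]] := step_saddle hGm s2'.
have [t1' [p1' [q1' S1']]] := step_saddle hGm s1'.
rewrite (tedge_labelled w S1) (tedge_labelled w S2') !band_linear.
rewrite (eq_band _ _ _ (fun w => tedge_labelled w S2)) (eq_band _ _ _ (fun w => tedge_labelled w S1')).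
have endsU (l : 'I_(msize M)) : ends l \subset unmatched M.
  by apply/subsetP => x xl; exact: (ends_unmatched hGm xl).
have Zi : class_invariant (connect (adj ga)) (labelled (F := F) ga).
  by move=> p q w' x; apply: labelled_class.
have Zl : slot_linear (unmatched M) (labelled (F := F) ga).
  by move=> p w'; apply: labelled_linear.
(* Both sums are the difference between the numbers of circles of [ga] and [al]. *)
have te : t1 + t2 = t2' + t1'.
  have c1 := saddle_card hGm S1; have c2 := saddle_card hGm S2.
  have c2' := saddle_card hGm S2'; have c1' := saddle_card hGm S1'.
  by apply: (@addrI _ (#|circle al|)%:Z); rewrite !addrA -c1 -c2 -c2' -c1'.
exact: (band_square hF w (endsU j) (endsU k) (adj_equiv al) (adj_equiv be)
  (adj_equiv be') (adj_equiv ga) Zi Zl S1 S2 S2' S1' te).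
Qed.

Lemma dif_dif (i : int) (v : Cx gens P s M i) :
  dif gens P s M (i + 1) (dif gens P s M i v) = 0.
Proof.
apply/ffunP => ga; rewrite [RHS]ffunE ffunE /=.
transitivity (\sum_(be : level M (i + 1)) \sum_(k | step (val be) (val ga) k)
    \sum_(al : level M i) \sum_(j | step (val al) (val be) j)
      (-1) ^+ sgn_exp (val be) k *: ((-1) ^+ sgn_exp (val al) j *:
        tedge (val be) (val ga) k (tedge (val al) (val be) j (v al)))).
  apply: eq_bigr => be _; apply: eq_bigr => k _.
  rewrite -[edge_map _ _ _ _ _ _ _]/(tedge (val be) (val ga) k _) ffunE.
  rewrite linear_sum scaler_sumr; apply: eq_bigr => al _.
  rewrite linear_sum scaler_sumr; apply: eq_bigr => j _.
  by rewrite linearZ.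
under eq_bigr do rewrite exchange_big /=; rewrite exchange_big /=.
apply: big1 => al _.
rewrite -[RHS](@sum_squares _ _ _ (fun al => tpow V (circle al)) (fun al be j => tedge al be j)
  tedge_comm (val al) (val ga) (v al)) /=.
pose X (be : state M) j k : tpow V (circle (val ga)) :=
  (-1) ^+ sgn_exp be k *: ((-1) ^+ sgn_exp (val al) j *:
    tedge be (val ga) k (tedge (val al) be j (v al))).
(* The step conditions become conditional terms so that [be] can be summed innermost, where
   [sum_level_step] eliminates it. *)
transitivity (\sum_(be : level M (i + 1)) \sum_j \sum_k
    if step (val al) (val be) j then
      if step (val be) (val ga) k then X (val be) j k else 0 else 0).
  apply: eq_bigr => be _; rewrite big_mkcond [RHS]exchange_big /=.
  apply: eq_bigr => k _; case: (step (val be) _ k); first by rewrite big_mkcond.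
  by rewrite big1 // => j _; rewrite if_same.
rewrite exchange_big; apply: eq_bigr => j _.
rewrite exchange_big; apply: eq_bigr => k _.
exact: (sum_level_step al j
  (fun be => if step be (val ga) k then X be j k else 0)).
Qed.

End Complex.

Theorem theorem3p3p14 (R : comPzRingType) (F : MTQFT R)
    (hF : mt_F F (mc_cmp mc_m mc_m) =1 mt_F F (mc_cmp mc_mu mc_Delta))
    (G : zmodType) (m : nat) (gens : 'I_m -> G) (hgens : generates gens)
    (P : G -> mt_V F -> Prop) (hP : is_grading P)
    (s : 'I_m -> int)
    (Gm : ribbon) (M : matching Gm) (hGm : trivalent Gm)
    (i : int) (v : Cx gens P s M i) :
  dif gens P s M (i + 1) (dif gens P s M i v) = 0.
Proof. exact: dif_dif. Qed.
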